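(* There is a universal constant $C>0$ with the following property. Fix $n\in\mathbb N$, a normed space $\mathbf X=(\mathbb R^n,\|\cdot\|_{\mathbf X})$ and a Banach space $(\mathbf Z,\|\cdot\|_{\mathbf Z})$. Suppose that $\mathscr C\subseteq\mathbb R^n$ and that $f:\mathscr C\to\mathbf Z$ satisfies $\|f(x)-f(y)\|_{\mathbf Z}\le\|x-y\|_{\mathbf X}$ for every $x,y\in\mathscr C$. Then there exists $F:\mathbb R^n\to\mathbf Z$ that coincides with $f$ on $\mathscr C$ and satisfies $$\forall x,y\in\mathbb R^n,\qquad\|F(x)-F(y)\|_{\mathbf Z}\le C\,\frac{\|x-y\|_{\Pi^*\mathbf X}}{\mathrm{vol}_n(B_{\mathbf X})}.$$
   Context: All vector spaces are real. $B_{\mathbf X}$ is the closed unit ball of $\mathbf X$. The norm $\|\cdot\|_{\Pi^*\mathbf X}$ on $\mathbb R^n$ (whose unit ball is the polar projection body of $B_{\mathbf X}$) is defined for $x\in\mathbb R^n\setminus\{0\}$ by $$\|x\|_{\Pi^*\mathbf X}=\frac12\int_{\partial B_{\mathbf X}}|\langle x,N(y)\rangle|\,dy=\mathrm{vol}_{n-1}\big(\mathrm{Proj}_{x^\perp}B_{\mathbf X}\big)\|x\|_{\ell_2^n},$$ where $N(y)$ is the (almost everywhere defined) unit outer normal to $\partial B_{\mathbf X}$ at $y$, integration is with respect to $(n-1)$-dimensional Hausdorff measure, and $\mathrm{Proj}_{x^\perp}$ is the orthogonal projection onto the hyperplane $x^\perp$. *)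

(* Defs.v *)
From HB Require Import structures.
From mathcomp Require Import all_boot all_order all_algebra.
From mathcomp Require Import all_classical all_reals all_analysis.
From mathcomp Require Import ring.
Import Order.TTheory GRing.Theory Num.Theory.
Import numFieldNormedType.Exports.

Set Implicit Arguments.
Unset Strict Implicit.
Unset Printing Implicit Defensive.

Local Open Scope classical_set_scope.
Local Open Scope ring_scope.

Section lebesgue_tuple_step.
Context {R : realType} (n : nat).
Notation TR := (measurableTypeR R).
Variable m : {sigma_finite_measure set (n.-tuple TR) -> \bar R}.

Definition cons_pair (p : (TR * n.-tuple TR)%type) : n.+1.-tuple TR :=
  [the n.+1.-tuple TR of p.1 :: p.2].

Lemma measurable_cons_pair : measurable_fun setT cons_pair.
Proof. exact: measurable_cons. Qed.

Definition lebesgue_cons : set (n.+1.-tuple TR) -> \bar R :=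
  pushforward (@lebesgue_measure R \x m)%E cons_pair.

Let nu : {measure set (n.+1.-tuple TR) -> \bar R} :=
  measure_function_pushforward__canonical__measure_function_Measure
    (@lebesgue_measure R \x m)%E measurable_cons_pair.

HB.instance Definition _ := isMeasure.Build _ _ _ lebesgue_cons
  (measure0 nu) (measure_ge0 nu) (@measure_semi_sigma_additive _ _ _ nu).

Lemma lebesgue_cons_sigma_finite : sigma_finite setT lebesgue_cons.
Proof.
have /sigma_finiteP[F [TF ndF Foo]] := sigma_finiteT (@lebesgue_measure R).
have /sigma_finiteP[G [TG ndG Goo]] := sigma_finiteT m.
pose u (t : n.+1.-tuple TR) : (TR * n.-tuple TR)%type := (thead t, [tuple of behead t]).
have mu : measurable_fun setT u.
  apply/measurable_fun_pair.
    exact: measurable_tnth.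
  exact: measurable_behead.
exists (fun k => u @^-1` (F k `*` G k)).
  rewrite -preimage_bigcup -[LHS](preimage_setT u); congr (_ @^-1` _).
  rewrite -setXTT TF TG predeqE => -[x y]; split.
    move=> [/= [i _ Fx] [j _ Gy]]; exists (maxn i j) => //; split.
      by move: x Fx; exact/subsetPset/ndF/leq_maxl.
    by move: y Gy; exact/subsetPset/ndG/leq_maxr.
  by move=> [i _ []/= ? ?]; split; exists i.
move=> k; have [mF Fk] := Foo k; have [mG Gk] := Goo k; split.
  by rewrite -[X in measurable X]setTI; apply: mu => //; exact: measurableX.
rewrite /lebesgue_cons /pushforward -comp_preimage.
rewrite (_ : u \o cons_pair = id) ?preimage_id; last first.
  by apply/funext => -[x t]; rewrite /u/=; congr pair => //; exact/val_inj.
by rewrite product_measure1E// lte_mul_pinfty// ge0_fin_numE.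
Qed.

HB.instance Definition _ := @Measure_isSigmaFinite.Build _ _ _ lebesgue_cons
  lebesgue_cons_sigma_finite.

End lebesgue_tuple_step.

Fixpoint lebesgue_tuple {R : realType} (n : nat) :
    {sigma_finite_measure set (n.-tuple (measurableTypeR R)) -> \bar R} :=
  match n with
  | 0 => @dirac _ (0.-tuple (measurableTypeR R)) [tuple] R
  | m.+1 => lebesgue_cons (lebesgue_tuple m)
  end.

Lemma lebesgue_tuple_setX {R : realType} (n : nat)
    (A : 'I_n -> set (measurableTypeR R)) : (forall i, measurable (A i)) ->
  lebesgue_tuple n [set t | forall i, A i (tnth t i)] =
  (\prod_(i < n) @lebesgue_measure R (A i))%E.
Proof.
elim: n A => [|n IHn] A mA /=.
  by rewrite big_ord0 diracE mem_set// => -[].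
rewrite big_ord_recl /lebesgue_cons /pushforward.
set B := [set t | forall i : 'I_n, A (lift ord0 i) (tnth t i)].
have mB : measurable B.
  rewrite (_ : B =
    \bigcap_(i in [set: 'I_n]) ((@tnth _ _)^~ i @^-1` A (lift ord0 i))).
    apply: fin_bigcap_measurable => // i _.
    by rewrite -[X in measurable X]setTI; exact: measurable_tnth.
  by apply/seteqP; split => t /= h i; [move=> _|]; exact: h.
rewrite (_ : _ @^-1` _ =
    A ord0 `*` B).
  by rewrite product_measure1E//; congr (_ * _)%E; exact: IHn.
apply/seteqP; split => -[x t] /=.
  move=> h; split; first exact: (h ord0).
  by move=> i; have := h (lift ord0 i); rewrite tnthS.
by move=> [Ax At] i; case: (unliftP ord0 i) => [j|] ->; rewrite ?tnthS.
Qed.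

Section projection_body.
Context {R : realType}.

Definition vol (n : nat) (A : set 'rV[R]_n) : \bar R :=
  lebesgue_tuple n [set t | A (\row_i tnth t i)].

Definition dotv (n : nat) (u v : 'rV[R]_n) : R := (u *m v^T) 0 0.

(* The library's norm on 'rV[R]_n is the sup norm. *)
Definition l2norm (n : nat) (u : 'rV[R]_n) : R := Num.sqrt (dotv u u).

Definition is_norm (n : nat) (N : 'rV[R]_n -> R) : Prop :=
  [/\ forall x y, N (x + y) <= N x + N y,
      forall (a : R) x, N (a *: x) = `|a| * N x &
      forall x, N x = 0 -> x = 0].

Definition unit_ball (n : nat) (N : 'rV[R]_n -> R) : set 'rV[R]_n :=
  [set x | N x <= 1].

Definition proj_hyperplane (n : nat) (x y : 'rV[R]_n) : 'rV[R]_n :=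
  y - (dotv x y / dotv x x) *: x.

(* For x != 0, the rows of Q form an orthonormal basis of the hyperplane
   orthogonal to x. *)
Definition hyperplane_frame (n : nat) (x : 'rV[R]_n) (Q : 'M[R]_(n.-1, n)) :
    Prop :=
  Q *m Q^T = 1%:M /\ Q *m x^T = 0.

Lemma exists_orthogonal_row0 (n : nat) (e : 'rV[R]_n.+1) : dotv e e = 1 ->
  exists2 H : 'M[R]_n.+1, H *m H^T = 1%:M & row 0 H = e.
Proof.
move=> e1; pose e0 : 'rV[R]_n.+1 := delta_mx 0 0; pose w := e - e0.
pose s := dotv w w.
have [w0|w0] := eqVneq w 0.
  exists 1%:M; first by rewrite trmx1 mulmx1.
  by rewrite rowE mulmx1; apply/esym/eqP; rewrite -subr_eq0 -/e0 -/w w0.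
have ww : w *m w^T = s%:M.
  by apply/matrixP => i j; rewrite !ord1 !mxE mulr1n /s /dotv mxE.
have s_neq0 : s != 0.
  apply/eqP => s0; move/eqP: w0; apply; apply/rowP => i; rewrite [RHS]mxE.
  have /eqP : \sum_j w 0 j ^+ 2 = 0.
    rewrite -[RHS]s0 /s /dotv mxE; apply: eq_bigr => j _.
    by rewrite [w^T _ _]mxE expr2.
  rewrite psumr_eq0 => [/allP/(_ i)|j _]; last exact: sqr_ge0.
  by rewrite mem_index_enum sqrf_eq0 => /(_ isT)/eqP.
have sE : s = 2 * (1 - e 0 0).
  have dE : forall u : 'rV[R]_n.+1, e0 *m u^T = (u 0 0)%:M.
    move=> u; apply/matrixP => i j.
    by rewrite !ord1 -rowE !mxE mulr1n.
  have dE' : e *m e0^T = (e 0 0)%:M.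
    by rewrite -[LHS]trmxK trmx_mul trmxK dE tr_scalar_mx.
  have ee : e *m e^T = 1%:M.
    by apply/matrixP => i j; rewrite !ord1 -[LHS]/(dotv e e) e1 !mxE.
  rewrite /s /dotv /w linearB/= mulmxBl !mulmxBr ee dE dE' dE !mxE !eqxx !mulr1n.
  by ring.
pose H : 'M[R]_n.+1 := 1%:M - (2 / s) *: (w^T *m w).
have HT : H^T = H.
  by rewrite /H linearB/= linearZ/= trmx_mul trmxK trmx1.
exists H.
  rewrite HT [in X in _ *m X]/H mulmxBr mulmx1 -scalemxAr [in X in X *m _]/H mulmxBl mul1mx -scalemxAl.
  have -> : w^T *m w *m (w^T *m w) = s *: (w^T *m w).
    by rewrite mulmxA -(mulmxA w^T w) ww mul_mx_scalar -scalemxAl.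
  rewrite scalerA divfK// scaler_nat mulr2n opprD addNKr scalerN opprK.
  by rewrite /H subrK.
rewrite rowE mulmxBr mulmx1 -scalemxAr mulmxA.
have -> : delta_mx 0 0 *m w^T = (e 0 0 - 1)%:M :> 'M[R]_1.
  by apply/matrixP => i j; rewrite !ord1 -rowE !mxE !eqxx !mulr1n.
rewrite mul_scalar_mx scalerA (_ : 2 / s * _ = -1).
  by rewrite scaleN1r opprK /w addrC subrK.
have : 2 * (1 - e 0 0) != 0 by rewrite -sE.
rewrite sE mulf_eq0 negb_or => /andP[_ h]; by field.
Qed.

Lemma exists_hyperplane_frame (n : nat) (x : 'rV[R]_n) :
  exists Q, hyperplane_frame x Q.
Proof.
case: n x => [|n] x.
  by exists 0; split; apply/matrixP => -[].
have [e e1 [c xe]] : exists2 e : 'rV[R]_n.+1, dotv e e = 1 &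
    exists c, x = c *: e.
  have [->|x0] := eqVneq x 0.
    exists (delta_mx 0 0); last by exists 0; rewrite scale0r.
    by rewrite /dotv -rowE !mxE !eqxx.
  have xx : dotv x x = \sum_j x 0 j ^+ 2.
    by rewrite /dotv mxE; apply: eq_bigr => j _; rewrite mxE expr2.
  have xx_gt0 : 0 < dotv x x.
    rewrite lt_def xx sumr_ge0 ?andbT => [|j _]; last exact: sqr_ge0.
    apply/eqP => /eqP; move/eqP: x0 => x0.
    rewrite psumr_eq0 => [/allP s0|j _]; last exact: sqr_ge0.
    apply: x0; apply/rowP => i; rewrite [RHS]mxE; apply/eqP.
    by have := s0 i; rewrite mem_index_enum sqrf_eq0 => /(_ isT).
  have l_neq0 : l2norm x != 0 by rewrite sqrtr_eq0 -ltNge.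
  exists ((l2norm x)^-1 *: x); last first.
    by exists (l2norm x); rewrite scalerA divff// scale1r.
  have lE : dotv x x = l2norm x * l2norm x.
    by rewrite -expr2 sqr_sqrtr// ltW.
  rewrite /dotv linearZ/= -scalemxAl -scalemxAr scalerA mxE -/(dotv x x) lE.
  by field.
have [H HH H0] := exists_orthogonal_row0 e1.
exists (\matrix_(i, j) H (lift 0 i) j); split.
  apply/matrixP => i j.
  have /matrixP/(_ (lift 0 i) (lift 0 j)) := HH; rewrite !mxE => hij.
  rewrite -[i == j](inj_eq (@lift_inj _ 0)) -hij.
  by apply: eq_bigr => k _; rewrite !mxE.
rewrite xe linearZ/= -scalemxAr; apply/matrixP => i j; rewrite ord1 !mxE.
have /matrixP/(_ (lift 0 i) 0) := HH; rewrite !mxE/= => h.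
rewrite (_ : \sum_k _ = 0) ?mulr0// -[RHS]h.
by apply: eq_bigr => k _; rewrite !mxE -H0 !mxE.
Qed.

(* The volume of a subset of the hyperplane orthogonal to x, in the coordinates
   of an arbitrarily chosen orthonormal basis of that hyperplane; by rotation
   invariance of Lebesgue measure, it does not depend on the chosen basis. *)
Definition vol_hyperplane (n : nat) (x : 'rV[R]_n) (A : set 'rV[R]_n) :
    \bar R :=
  vol [set u | A (u *m xget 0 [set Q | hyperplane_frame x Q])].

(* By Cauchy's projection formula, this is also half of the integral of
   |<x, N(y)>| over the boundary of the unit ball, N(y) being the unit outer
   normal at y. For x = 0 the value is 0, whatever the first factor. *)
Definition polar_projection_norm (n : nat) (N : 'rV[R]_n -> R)
    (x : 'rV[R]_n) : R :=
  fine (vol_hyperplane x (proj_hyperplane x @` unit_ball N)) * l2norm x.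

End projection_body.

(* Main.v *)
Require Import Defs.
From mathcomp Require Import all_boot all_order all_algebra.
From mathcomp Require Import all_classical all_reals all_analysis.
From mathcomp Require Import measurable_realfun ring lra zify.
Import Order.TTheory GRing.Theory Num.Theory.
Import numFieldNormedType.Exports.

Set Implicit Arguments.
Unset Strict Implicit.
Unset Printing Implicit Defensive.

Local Open Scope classical_set_scope.
Local Open Scope ring_scope.

(** The extension is an explicit interpolation between averages over balls of
    dyadic radii, and the projection norm enters through a single geometric
    estimate.

    Write rho(v) for the polar projection norm of v divided by the volume of the
    unit ball. Cut the unit ball B into chords parallel to v. When B is
    translated by v, each chord sticks out of its old position only within an
    interval of length |v|, and the set of chords is the shadow of B on the
    hyperplane orthogonal to v. Hence the volume of (v + B) minus B is at most
    |v| times the volume of the shadow ([vol_shifted_nball], [vol_nball_diff]).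
    Rescaling, two balls of radius r centred at x and y differ by at most the
    fraction 2 rho(x - y) / r of their volume ([fine_vol_nball_setD]); taking v
    so long that v + B and B are disjoint gives N <= 3 rho
    ([is_norm_le_rho]). This needs the behaviour of Lebesgue measure under
    rotations and dilations, both of which follow from uniqueness of the
    translation-invariant measure ([vol_linear]).

    Fix r > 0 and let A_r(x) be the average of f o pi over the ball of radius r
    centred at x, where pi sends a point to an almost nearest point of D. Choosing
    pi constant on the cells of a fine grid turns the average into a finite
    convex combination of values of f, so that no Z-valued integral is needed.
    Then A_r(x) is within N(x - a) + dist(x, D) + 5 r of f(a) for each a in D, and
    the estimate on balls makes A_r(x) - A_r(y) at most rho(x - y) / r times a
    constant multiple of r + dist(x, D) + N(x - y) ([ball_average]).

    Averaging at scale r is thus rho-Lipschitz at points whose distance to D is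
    comparable to r, and F(x) uses just these scales: it interpolates linearly in
    t = dist(x, D) between the values A_(2^k)(x) at t = 2^k. Letting the radius
    depend continuously on x instead would cost a factor of the dimension, since
    the volume of a ball is a high power of its radius; changing the weights of
    two fixed scales costs only a constant. On the closure of D, F is the limit
    given by completeness of Z. Two points that are close compared with their
    distance to D are handled by the Lipschitz estimates for the interpolation
    and for the averages ([multiscale_extension]); two points that are far apart
    in this sense are compared through a point of D, with N <= 3 rho
    ([lipschitz_extension]). *)

(** * Lebesgue measure on row vectors *)

Section row_measure.
Context {R : realType}.
Local Notation TR := (measurableTypeR R).

Lemma lebesgue_measure_translate (v : R) (A : set R) : measurable A ->
  pushforward (@lebesgue_measure R) (fun x : TR => x + v : TR) A =
  lebesgue_measure A.
Proof.
have mT : measurable_fun [set: TR] (fun x : TR => x + v : TR).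
  exact: measurable_funD.
pose nu : {measure set TR -> \bar R} :=
  measure_function_pushforward__canonical__measure_function_Measure
    (@lebesgue_measure R) mT.
move=> mA; apply/esym; apply: (@lebesgue_measure_unique R nu) => //= _ [[a b]] _ <-.
rewrite /nu/= /pushforward.
have -> : (fun x : TR => x + v) @^-1` `]a, b] = `]a - v, b - v]%classic.
  by apply/seteqP; split => x /=; rewrite !in_itv/= ltrBlDr lerBrDr.
rewrite !lebesgue_measure_itv/= !lte_fin ltrD2r; case: ifP => // _.
by rewrite -!EFinD; congr (_%:E); ring.
Qed.

Lemma ge0_integral_translate (v : R) (f : R -> \bar R) :
  measurable_fun [set: TR] f -> (forall r, (0 <= f r)%E) ->
  (\int[@lebesgue_measure R]_r f (r + v)%R = \int[@lebesgue_measure R]_r f r)%E.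
Proof.
move=> mf f0.
have mT : measurable_fun [set: TR] (fun x : TR => x + v : TR).
  exact: measurable_funD.
transitivity (\int[@lebesgue_measure R]_(r in (fun x : TR => x + v : TR)%R @^-1` setT)
   (f \o (fun x : R => x + v)%R) r)%E; first by rewrite preimage_setT.
rewrite -(ge0_integral_pushforward mT)//.
by apply: eq_measure_integral => //= A mA _; exact: lebesgue_measure_translate.
Qed.

Section rows.
Variable n : nat.
Implicit Types (A : set 'rV[R]_n).

Definition rowt (t : n.-tuple TR) : 'rV[R]_n := \row_i tnth t i.
Definition tplr (v : 'rV[R]_n) : n.-tuple TR := [tuple (v 0 i : TR) | i < n].

Lemma tplrK : cancel tplr rowt.
Proof. by move=> v; apply/rowP => i; rewrite mxE tnth_mktuple. Qed.

(** [vol] is defined through tuples of coordinates, so the relevant sigma-algebra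
    on row vectors is the one transported from tuples. *)
Definition vmeas A := measurable (rowt @^-1` A).

(** Measurability of a map into row vectors, tested on coordinates. *)
Definition vmeas_map d (T : measurableType d) (h : T -> 'rV[R]_n) :=
  forall i, measurable_fun setT (fun t => h t 0 i : TR).

Lemma vmeas_preimage d (T : measurableType d) (h : T -> 'rV[R]_n) A :
  vmeas_map h -> vmeas A -> measurable (h @^-1` A).
Proof.
move=> mh mA.
have : measurable_fun setT (tplr \o h).
  apply/(@measurable_fun_tnthP _ _ _ TR) => i; rewrite (_ : _ \o _ = fun t => h t 0 i)//.
  by apply/funext => t /=; rewrite tnth_mktuple.
move=> /(_ measurableT _ mA); rewrite setTI; congr measurable.
by apply/seteqP; split => t /=; rewrite tplrK.
Qed.

Lemma vmeas_rowt : vmeas_map rowt.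
Proof.
move=> i; rewrite (_ : (fun _ => _) = (@tnth _ _)^~ i).
  exact: measurable_tnth.
by apply/funext => t /=; rewrite mxE.
Qed.

Lemma vmeas_map_comp d d' (T : measurableType d) (T' : measurableType d')
   (h : T -> 'rV[R]_n) (g : T' -> T) :
  vmeas_map h -> measurable_fun setT g -> vmeas_map (h \o g).
Proof.
by move=> mh mg i; exact: (measurableT_comp (mh i) mg).
Qed.

Lemma vmeas_mapD d (T : measurableType d) (h g : T -> 'rV[R]_n) :
  vmeas_map h -> vmeas_map g -> vmeas_map (fun t => h t + g t).
Proof.
move=> mh mg i; rewrite (_ : (fun _ => _) = (fun t => h t 0 i + g t 0 i)).
  exact: measurable_funD (mh i) (mg i).
by apply/funext => t /=; rewrite mxE.
Qed.

Lemma vmeas_mapN d (T : measurableType d) (h : T -> 'rV[R]_n) :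
  vmeas_map h -> vmeas_map (fun t => - h t).
Proof.
move=> mh i; rewrite (_ : (fun _ => _) = (fun t => - h t 0 i)).
  exact: measurable_funN (mh i).
by apply/funext => t /=; rewrite mxE.
Qed.

Lemma vmeas_map_cst d (T : measurableType d) (v : 'rV[R]_n) :
  vmeas_map (fun _ : T => v).
Proof. by move=> i; exact: measurable_cst. Qed.

Lemma volE A : vol A = lebesgue_tuple n (rowt @^-1` A).
Proof. by []. Qed.

End rows.

Lemma vmeas_map_mulmx n m d (T : measurableType d) (h : T -> 'rV[R]_n)
  (L : 'M[R]_(n, m)) :
  vmeas_map h -> vmeas_map (fun t => h t *m L).
Proof.
move=> mh i; rewrite (_ : (fun _ => _) = (fun t => \sum_j h t 0 j * L j i)).
  apply: (@measurable_sum _ _ _ _ _ _ (fun j t => h t 0 j * L j i)) => j.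
  exact: measurable_funM (mh j) (measurable_cst _).
by apply/funext => t /=; rewrite mxE.
Qed.

Definition rowc n (s : R) (u : 'rV[R]_n) : 'rV[R]_n.+1 := row_mx s%:M u.

Lemma rowt_cons n (p : TR * n.-tuple TR) : rowt (cons_pair p) = rowc p.1 (rowt p.2).
Proof.
apply/rowP => i; rewrite mxE /rowc.
have [j ->|j ->] := split_ordP (i : 'I_(1 + n)).
  rewrite [RHS]row_mxEl !ord1 mxE/= mulr1n.
  have e : lshift n (0 : 'I_1) = ord0 :> 'I_n.+1 by exact/val_inj.
  by rewrite [X in tnth _ X]e.
have e : rshift 1 j = lift ord0 j :> 'I_n.+1 by exact/val_inj.
by rewrite [RHS]row_mxEr mxE [X in tnth _ X]e tnthS.
Qed.

Lemma vmeas_rowc n d (T : measurableType d) (f : T -> TR) (h : T -> 'rV[R]_n) :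
  measurable_fun setT f -> vmeas_map h -> vmeas_map (fun t => rowc (f t) (h t)).
Proof.
move=> mf mh i; have [j ->|j ->] := split_ordP (i : 'I_(1 + n)).
  rewrite (_ : (fun _ => _) = f)//; apply/funext => t.
  by rewrite /rowc [LHS]row_mxEl !ord1 mxE mulr1n.
rewrite (_ : (fun _ => _) = (fun t => h t 0 j))//; apply/funext => t.
by rewrite /rowc [LHS]row_mxEr.
Qed.

Lemma product_measure12 d1 d2 (T1 : measurableType d1) (T2 : measurableType d2)
  (m1 : {sigma_finite_measure set T1 -> \bar R})
  (m2 : {sigma_finite_measure set T2 -> \bar R}) X : measurable X ->
  ((m1 \x m2) X = (m1 \x^ m2) X)%E.
Proof.
move=> mX; apply: (@product_measure_unique _ _ _ _ _ m1 m2 (m1 \x^ m2)%E) => //.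
by move=> A B mA mB; exact: product_measure2E.
Qed.

Lemma vol_cons n (A : set 'rV[R]_n.+1) :
  vol A = (\int[@lebesgue_measure R]_s vol [set u | A (rowc s u)])%E.
Proof.
rewrite volE /= /lebesgue_cons /pushforward /product_measure1.
apply: eq_integral => s _ /=; rewrite volE; congr (lebesgue_tuple n _).
by apply/seteqP; split => t; rewrite /xsection/= inE/= rowt_cons.
Qed.

(** Tonelli: the first coordinate is integrated first, unlike in [vol_cons]. *)
Lemma vol_snoc n (A : set 'rV[R]_n.+1) : vmeas A ->
  vol A = (\int[lebesgue_tuple n]_u
     @lebesgue_measure R [set s | A (rowc s (rowt u))])%E.
Proof.
move=> mA; rewrite volE /= /lebesgue_cons /pushforward product_measure12; last first.
  by rewrite -[X in measurable X]setTI; apply: measurable_cons_pair.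
rewrite /product_measure2; apply: eq_integral => s _ /=; congr lebesgue_measure.
by apply/seteqP; split => t; rewrite /ysection/= inE/= rowt_cons.
Qed.

Lemma measurable_vol_section n (A : set 'rV[R]_n.+1) : vmeas A ->
  measurable_fun [set: TR] (fun s => vol [set u | A (rowc s u)]).
Proof.
move=> mA.
have m2 : measurable (@cons_pair R n @^-1` (@rowt n.+1 @^-1` A)).
  by rewrite -[X in measurable X]setTI; apply: measurable_cons_pair.
have := measurable_fun_xsection (lebesgue_tuple n) m2.
congr measurable_fun; apply/funext => s /=; rewrite volE; congr (lebesgue_tuple n _).
by apply/seteqP; split => t; rewrite /xsection/= inE/= rowt_cons.
Qed.

Lemma vol_translate n (v : 'rV[R]_n) (A : set 'rV[R]_n) : vmeas A ->
  vol [set x | A (x + v)] = vol A.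
Proof.
elim: n v A => [|n IH] v A mA.
  by congr vol; apply/seteqP; split => x /=; rewrite (_ : x + v = x)//;
    apply/rowP => -[].
rewrite vol_cons [RHS]vol_cons.
pose v0 := v 0 0; pose w : 'rV[R]_n := rsubmx (v : 'rV_(1 + n)).
have vE s u : rowc s u + v = rowc (s + v0) (u + w).
  rewrite /rowc [X in _ + X = _](_ : v = row_mx v0%:M w); last first.
    rewrite -[LHS](@hsubmxK _ 1 1 n) -/w (_ : lsubmx _ = v0%:M)//.
    apply/rowP => i; rewrite !ord1 !mxE mulr1n; congr (v _ _).
    exact/val_inj.
  by rewrite /rowc raddfD; exact: (@add_row_mx R 1 1 n).
transitivity (\int[@lebesgue_measure R]_s vol [set u | A (rowc (s + v0)%R u)])%E.
  apply: eq_integral => s _ /=.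
  rewrite (_ : [set u | A (rowc s u + v)] =
    [set u | [set u' | A (rowc (s + v0) u')] (u + w)]).
    apply: IH; rewrite /vmeas.
    apply: (vmeas_preimage (h := fun t => rowc (s + v0) (rowt t)) _ mA).
    by apply: vmeas_rowc; [exact: measurable_cst|exact: vmeas_rowt].
  by apply/seteqP; split => u /=; rewrite vE.
rewrite (ge0_integral_translate v0 (f := fun s => vol [set u | A (rowc s u)]))//.
exact: measurable_vol_section.
Qed.

(** Uniqueness of the translation-invariant measure, in the form that it takes for
    the image under L: integrate the indicator of A(xL + y) and E(y) over all
    pairs (x, y). Integrating in x first and translating x gives the left side.
    Translating y by xL first turns the integrand into A(y) and E(y - xL), whose
    integral is the right side because E is symmetric. Testing on a single E then
    determines the factor by which L scales volumes. *)
Lemma vol_linear n (L : 'M[R]_n) (A E : set 'rV[R]_n) : L \in unitmx ->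
  vmeas A -> vmeas E -> (forall x, E (- x) <-> E x) ->
  (vol [set x | A (x *m L)%R] * vol E = vol [set x | E (x *m L)%R] * vol A)%E.
Proof.
move=> uL mA mE symE.
have mL B : vmeas B -> vmeas [set x | B (x *m L)].
  move=> mB; apply: (vmeas_preimage (h := fun t => rowt t *m L) _ mB).
  by apply: vmeas_map_mulmx; exact: vmeas_rowt.
have mf : vmeas_map (fun p : n.-tuple TR * n.-tuple TR => rowt p.1).
  apply: (vmeas_map_comp (g := fst) (@vmeas_rowt n)); exact: measurable_fst.
have ms : vmeas_map (fun p : n.-tuple TR * n.-tuple TR => rowt p.2).
  apply: (vmeas_map_comp (g := snd) (@vmeas_rowt n)); exact: measurable_snd.
pose S1 := [set p : n.-tuple TR * n.-tuple TR |
  A (rowt p.1 *m L + rowt p.2) /\ E (rowt p.2)].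
pose S2 := [set p : n.-tuple TR * n.-tuple TR |
  A (rowt p.2) /\ E (rowt p.2 - rowt p.1 *m L)].
have mS1 : measurable S1.
  apply: measurableI; last exact: (vmeas_preimage ms mE).
  by apply: (vmeas_preimage _ mA); apply: vmeas_mapD => //; exact: vmeas_map_mulmx.
have mS2 : measurable S2.
  apply: measurableI; first exact: (vmeas_preimage ms mA).
  apply: (vmeas_preimage _ mE); apply: vmeas_mapD => //.
  by apply: vmeas_mapN; exact: vmeas_map_mulmx.
pose mu := lebesgue_tuple n : {sigma_finite_measure set (n.-tuple TR) -> \bar R}.
have S12 : ((mu \x mu) S1 = (mu \x mu) S2)%E.
  apply: eq_integral => x _ /=; rewrite /xsection/=.
  transitivity (vol [set y | [set y' | A y' /\ E (y' - rowt x *m L)] (y + rowt x *m L)]).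
    rewrite volE; congr (mu _); apply/seteqP; split => y /=; rewrite inE/= addrK addrC//.
  rewrite vol_translate; first by rewrite volE; congr (mu _);
    apply/seteqP; split => y /=; rewrite inE.
  apply: measurableI; first exact: mA.
  apply: (vmeas_preimage _ mE); apply: vmeas_mapD; first exact: vmeas_rowt.
  exact: vmeas_map_cst.
have int_indic (B : set 'rV[R]_n) (c : \bar R) : (0 <= c)%E -> vmeas B ->
    (\int[mu]_y (c * (\1_(@rowt n @^-1` B) y)%:E) = c * vol B)%E.
  move=> c0 mB; rewrite ge0_integralZl//; last by apply/measurable_EFinP; exact: measurable_indic.
  by rewrite integral_indic// setIT volE.
have e1 : ((mu \x^ mu) S1 = vol [set x | A (x *m L)%R] * vol E)%E.
  rewrite -int_indic//; apply: eq_integral => y _ /=.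
  rewrite /ysection/= indicE; have [yE|yE] := pselect (E (rowt y)).
    rewrite mem_set// mule1.
    rewrite -(vol_translate (rowt y *m invmx L) (mL _ mA)) volE.
    congr (mu _); apply/seteqP; split => x /=; rewrite inE/= mulmxDl mulmxKV// => -[]//.
  rewrite memNset// mule0 -(measure0 mu); congr (mu _); apply/seteqP; split => x /=; last by [].
  by rewrite inE/= => -[_ /yE].
have e2 : ((mu \x^ mu) S2 = vol [set x | E (x *m L)%R] * vol A)%E.
  rewrite -int_indic//; apply: eq_integral => y _ /=.
  rewrite /ysection/= indicE; have [yE|yE] := pselect (A (rowt y)).
    rewrite mem_set// mule1.
    rewrite -(vol_translate (- (rowt y *m invmx L)) (mL _ mE)) volE.
    congr (mu _); apply/seteqP; split => x /=; rewrite inE/= mulmxDl mulNmx mulmxKV// -symE opprB.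
      by case.
    by split.
  rewrite memNset// mule0 -(measure0 mu); congr (mu _); apply/seteqP; split => x /=; last by [].
  by rewrite inE/= => -[/yE].
by rewrite -e1 -e2 -!product_measure12.
Qed.

End row_measure.

(** * Norms on a finite-dimensional space *)

Section norms_on_rows.
Context {R : realType}.
Local Notation TR := (measurableTypeR R).

Section one_norm.
Variables (n : nat) (N : 'rV[R]_n -> R).
Hypothesis hN : is_norm N.
Implicit Types x y : 'rV[R]_n.

Lemma is_norm_triangle x y : N (x + y) <= N x + N y.
Proof. by case: hN. Qed.

Lemma is_normZ (a : R) x : N (a *: x) = `|a| * N x.
Proof. by case: hN. Qed.

Lemma is_norm0 : N 0 = 0.
Proof. by rewrite -(scale0r (0 : 'rV[R]_n)) is_normZ normr0 mul0r. Qed.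

Lemma is_normN x : N (- x) = N x.
Proof. by rewrite -scaleN1r is_normZ normrN1 mul1r. Qed.

Lemma is_norm_ge0 x : 0 <= N x.
Proof.
have := is_norm_triangle x (- x); rewrite subrr is_norm0 is_normN -mulr2n.
by rewrite pmulrn_lge0.
Qed.

Lemma is_norm_gt0 x : x != 0 -> 0 < N x.
Proof.
move=> x0; rewrite lt_def is_norm_ge0 andbT; apply: contra x0 => /eqP Nx.
by case: hN => _ _ /(_ _ Nx) ->.
Qed.

Lemma is_normC x y : N (x - y) = N (y - x).
Proof. by rewrite -is_normN opprB. Qed.

Lemma is_norm_split y x z : N (x - z) <= N (x - y) + N (y - z).
Proof. by rewrite (le_trans _ (is_norm_triangle _ _))// addrA subrK. Qed.

Lemma is_norm_sum_coord x :
  N x <= \sum_i `|x 0 i| * N (delta_mx 0 i).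
Proof.
rewrite [in leLHS](row_sum_delta x).
elim/big_ind2 : _ => [|a b c d ab cd|i _]; first by rewrite is_norm0.
  by rewrite (le_trans (is_norm_triangle _ _))// lerD.
by rewrite is_normZ.
Qed.

Lemma coord_le_norm x i : `|x 0 i| <= `|x|.
Proof.
rewrite [leRHS]/Num.norm/= mx_normrE; apply/bigmax_geP; right => /=.
by exists (0, i).
Qed.

Lemma norm_le_coord x e : 0 <= e -> (forall i, `|x 0 i| <= e) -> `|x| <= e.
Proof.
move=> e0 xe; rewrite [leLHS]/Num.norm/= mx_normrE; apply/bigmax_leP; split => //.
by move=> [i j] _ /=; rewrite ord1.
Qed.

Lemma is_norm_le_norm : exists2 K : R, 0 < K & forall x, N x <= K * `|x|.
Proof.
exists (1 + \sum_i N (delta_mx 0 i)).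
  by rewrite ltr_wpDr// sumr_ge0// => i _; exact: is_norm_ge0.
move=> x; rewrite (le_trans (is_norm_sum_coord x))// mulrDl mul1r.
rewrite ler_wpDl// mulr_suml ler_sum// => i _; rewrite mulrC.
by rewrite ler_wpM2l ?is_norm_ge0// coord_le_norm.
Qed.

Lemma is_norm_dist x y : `|N x - N y| <= N (x - y).
Proof.
have h u v : N u <= N (u - v) + N v by rewrite -{1}(subrK v u) is_norm_triangle.
by rewrite ler_distl lerBlDr addrC is_normC h addrC is_normC h.
Qed.

Lemma is_norm_continuous : continuous N.
Proof.
have [K K0 NK] := is_norm_le_norm.
move=> x; apply/(@cvgrPdist_lt _ _ _ (nbhs x) (nbhs_filter x) N (N x)) => e e0.
have := nbhsx_ballx x (e / K) (divr_gt0 e0 K0); apply: filterS => y.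
rewrite -ball_normE/= ltr_pdivlMr// mulrC; apply: le_lt_trans.
by rewrite (le_trans (is_norm_dist _ _))// NK.
Qed.

(** All norms on a finite-dimensional space are equivalent: a continuous
    positive function is bounded below on the compact unit sphere. *)
Lemma norm_le_is_norm : exists2 c : R, 0 < c & forall x, `|x| <= c * N x.
Proof.
have [[x0 /eqP x00]|allx0] := pselect (exists x : 'rV[R]_n, x <> 0); last first.
  exists 1 => // x; have [->|/eqP] := eqVneq x 0.
    by rewrite normr0 is_norm0 mulr0.
  by move=> xn0; exfalso; apply: allx0; exists x.
pose S := [set x : 'rV[R]_n | `|x| = 1].
have unitS x : x != 0 -> S (`|x|^-1 *: x).
  by move=> xn0; rewrite /S/= normrZ normfV normr_id mulVf// normr_eq0.
have cS : compact S.
  apply: bounded_closed_compact.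
    by exists 1; split; [exact: num_real|move=> M M1 x /= ->; exact: ltW].
  rewrite (_ : S = (fun x : 'rV[R]_n => `|x|) @^-1` [set 1]); last by apply/seteqP; split.
  apply: (@closed_comp _ _ (fun x : 'rV[R]_n => `|x|) [set 1] _ (@closed_eq R 1)).
  by move=> x _; exact: (@norm_continuous R 'rV[R]_n).
have [] := compact_EVT_min (f := N) (A := S) _ cS.
- by exists (`|x0|^-1 *: x0); exact: unitS.
- by apply: continuous_subspaceT; exact: is_norm_continuous.
move=> m; rewrite inE => Sm Nmin.
have m0 : m != 0.
  by apply/eqP => m0; move: Sm; rewrite /S/= m0 normr0 => /eqP; rewrite eq_sym oner_eq0.
exists (N m)^-1; first by rewrite invr_gt0 is_norm_gt0.
move=> x; have [->|xn0] := eqVneq x 0; first by rewrite normr0 is_norm0 mulr0.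
have := Nmin (`|x|^-1 *: x); rewrite inE => /(_ (unitS _ xn0)).
rewrite is_normZ normfV normr_id ler_pdivlMl ?normr_gt0// => h.
by rewrite ler_pdivlMl ?is_norm_gt0// mulrC.
Qed.

Lemma rat_approx x (e : R) : 0 < e ->
  exists q : 'rV[rat]_n, forall i, `|x 0 i - ratr (q 0 i)| <= e.
Proof.
move=> e0.
have /choice[q qP] i : exists q : rat, `|x 0 i - ratr q| <= e.
  have [q] := @rat_in_itvoo R (x 0 i - e) (x 0 i + e) ltac:(lra).
  rewrite in_itv/= => /andP[q1 q2]; exists q; rewrite ler_distl; lra.
by exists (\row_i q i) => i; rewrite mxE.
Qed.

(** The product sigma-algebra contains the sublevel sets of N because, by
    density of the rationals and the Lipschitz bound for N, each of them is a
    countable union of sets cut out by finitely many coordinates. *)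
Lemma measurable_is_norm d (T : measurableType d) (h : T -> 'rV[R]_n) :
  vmeas_map h -> measurable_fun setT (fun t => N (h t) : TR).
Proof.
move=> mh; apply: (measurability _ (RGenInftyO.measurableE R)) => /= _ [_ [c ->] <-].
rewrite setTI.
pose rq (q : 'rV[rat]_n) : 'rV[R]_n := map_mx ratr q.
pose g q t : R := N (rq q) + \sum_i `|h t 0 i - rq q 0 i| * N (delta_mx 0 i).
have mg q : measurable_fun setT (g q : T -> TR).
  apply: measurable_funD; first exact: measurable_cst.
  apply: (@measurable_sum _ _ _ _ _ _ (fun i t => `|h t 0 i - rq q 0 i| * N (delta_mx 0 i))) => i.
  apply: measurable_funM; last exact: measurable_cst.
  apply: measurableT_comp; first exact: normr_measurable.
  by apply: measurable_funB; [exact: mh|exact: measurable_cst].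
rewrite (_ : _ @^-1` _ = \bigcup_q (g q @^-1` `]-oo, c[%classic)); last first.
  apply/seteqP; split => t /=; last first.
    move=> [q _] /=; rewrite !in_itv/=; apply: le_lt_trans.
    rewrite -{1}(subrK (rq q) (h t)) (le_trans (is_norm_triangle _ _))// addrC lerD2l.
    by rewrite (le_trans (is_norm_sum_coord _))//; apply: ler_sum => i _; rewrite !mxE.
  rewrite in_itv/= => tc; pose S : R := \sum_i N (delta_mx 0 i).
  have S0 : 0 <= S by rewrite sumr_ge0// => i _; exact: is_norm_ge0.
  have [q qP] := rat_approx (h t) (e := (c - N (h t)) / (2 * S + 1)) ltac:(rewrite divr_gt0//; lra).
  exists q => //=; rewrite in_itv/= /g.
  set s := \sum_i _.
  have Nq : N (rq q) <= N (h t) + s.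
    rewrite -{1}(subrK (h t) (rq q)) (le_trans (is_norm_triangle _ _))// addrC lerD2l.
    rewrite (le_trans (is_norm_sum_coord _))//; apply: ler_sum => i _; rewrite !mxE.
    by rewrite distrC.
  have sS : s <= (c - N (h t)) / (2 * S + 1) * S.
    rewrite mulr_sumr; apply: ler_sum => i _; rewrite ler_wpM2r ?is_norm_ge0//.
    by rewrite mxE.
  suff : (c - N (h t)) / (2 * S + 1) * S * 2 < c - N (h t) by lra.
  rewrite -mulrA mulrAC ltr_pdivrMr; last lra.
  rewrite ltr_pM2l; lra.
apply: countable_bigcupT_measurable => // q.
by rewrite -[X in measurable X]setTI; exact: mg.
Qed.

End one_norm.
End norms_on_rows.

(** * Rotations, dilations and volumes of balls *)

Section volumes.
Context {R : realType}.
Local Notation TR := (measurableTypeR R).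

Lemma vol_ge0 n (A : set 'rV[R]_n) : (0 <= vol A)%E.
Proof. exact: measure_ge0. Qed.

Lemma le_vol n (A B : set 'rV[R]_n) : vmeas A -> vmeas B -> A `<=` B ->
  (vol A <= vol B)%E.
Proof.
by move=> mA mB AB; apply: le_measure; rewrite ?inE// => t /=; exact: AB.
Qed.

Lemma mule_cancelr (x y e : \bar R) : (0 < e)%E -> e \is a fin_num ->
  (x * e = y * e)%E -> x = y.
Proof.
move=> e0 ef xy; apply/eqP; rewrite eq_le.
by rewrite -(lee_pmul2r ef e0) xy lexx -(lee_pmul2r ef e0) xy lexx.
Qed.

Definition cube n (a : R) : set 'rV[R]_n := [set x | forall i, `|x 0 i| <= a].
Arguments cube : clear implicits.

Lemma cubeE n (a : R) : @rowt R n @^-1` cube n a =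
  [set t | forall i, `[- a, a]%classic (tnth t i)].
Proof.
by apply/seteqP; split => t /= h i; move: (h i); rewrite mxE in_itv/= ler_norml.
Qed.

Lemma vmeas_cube n (a : R) : vmeas (cube n a).
Proof.
rewrite /vmeas cubeE (_ : [set t | _] =
    \bigcap_(i in [set: 'I_n]) ((@tnth _ TR)^~ i @^-1` `[- a, a]%classic)).
  apply: fin_bigcap_measurable => // i _.
  by rewrite -[X in measurable X]setTI; exact: measurable_tnth.
by apply/seteqP; split => t /= h i; [move=> _|]; exact: h.
Qed.

Lemma vol_cube n (a : R) : 0 <= a -> vol (cube n a) = ((2 * a) ^+ n)%:E.
Proof.
move=> a0; rewrite volE cubeE (@lebesgue_tuple_setX R n (fun=> `[- a, a]%classic))//.
rewrite (eq_bigr (fun _ => (2 * a)%:E)) => [|i _].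
  by rewrite prodEFin prodr_const card_ord.
rewrite lebesgue_measure_itv/= lte_fin; case: ltP => [_|aN]; last first.
  by congr (_%:E); lra.
by rewrite -EFinD; congr (_%:E); ring.
Qed.

Lemma vol_cube_gt0 n (a : R) : 0 < a -> (0 < vol (cube n a))%E.
Proof. by move=> a0; rewrite vol_cube ?ltW// lte_fin exprn_gt0// mulr_gt0. Qed.

Lemma vmeas_le n (f : 'rV[R]_n -> R) (c : R) :
  measurable_fun setT (fun t => f (rowt t) : TR) -> vmeas [set x | f x <= c].
Proof.
move=> mf; rewrite /vmeas (_ : _ @^-1` _ = (fun t => f (rowt t)) @^-1` `]-oo, c]%classic).
  by rewrite -[X in measurable X]setTI; exact: mf.
by apply/seteqP; split => t /=; rewrite in_itv.
Qed.

Lemma dotvE n (x y : 'rV[R]_n) : dotv x y = \sum_i x 0 i * y 0 i.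
Proof. by rewrite /dotv mxE; apply: eq_bigr => i _; rewrite mxE. Qed.

Definition euclidean_ball n : set 'rV[R]_n := [set x | dotv x x <= 1].
Arguments euclidean_ball : clear implicits.

Lemma vmeas_euclidean_ball n : vmeas (euclidean_ball n).
Proof.
apply: vmeas_le.
rewrite (_ : (fun _ => _) = (fun t : n.-tuple TR => \sum_i rowt t 0 i * rowt t 0 i)); last first.
  by apply/funext => t; rewrite dotvE.
apply: (@measurable_sum _ _ _ _ _ _ (fun i t => rowt t 0 i * rowt t 0 i)) => i.
by apply: measurable_funM; exact: vmeas_rowt.
Qed.

Lemma vol_euclidean_ball_gt0 n : (0 < vol (euclidean_ball n))%E.
Proof.
apply: (lt_le_trans (@vol_cube_gt0 n n.+1%:R^-1 _)); first by rewrite invr_gt0.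
apply: le_vol => [||x]; [exact: vmeas_cube|exact: vmeas_euclidean_ball|].
rewrite /cube/euclidean_ball/= dotvE => xa.
apply: (@le_trans _ _ (\sum_(i < n) n.+1%:R^-1)).
  apply: ler_sum => i _; rewrite -expr2 -real_normK ?num_real// expr2 -[leRHS]mulr1.
  by rewrite ler_pM// (le_trans (xa i))// invf_le1 ?ltr0n// ler1n.
by rewrite sumr_const card_ord -[_ *+ n]mulr_natl ler_pdivrMr ?ltr0n// mul1r ler_nat.
Qed.

Lemma vol_euclidean_ball_fin n : vol (euclidean_ball n) \is a fin_num.
Proof.
rewrite ge0_fin_numE ?vol_ge0//.
apply: (@le_lt_trans _ _ (vol (cube n 1))); last by rewrite vol_cube ?ltry.
apply: le_vol => [||x]; [exact: vmeas_euclidean_ball|exact: vmeas_cube|].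
rewrite /cube/euclidean_ball/= dotvE => xa i.
rewrite -(@ler_pXn2r _ 2) ?nnegrE// expr1n real_normK ?num_real//.
rewrite (le_trans _ xa)// (bigD1 i)//= -expr2 lerDl sumr_ge0// => j _.
by rewrite -expr2 sqr_ge0.
Qed.

(** The Euclidean ball is the test set: an orthogonal map preserves it. *)
Lemma vol_orthogonal n (H : 'M[R]_n) (A : set 'rV[R]_n) :
  H *m H^T = 1%:M -> vmeas A -> vol [set x | A (x *m H)] = vol A.
Proof.
move=> HH mA.
apply: (mule_cancelr (vol_euclidean_ball_gt0 n) (vol_euclidean_ball_fin n)).
rewrite vol_linear//; [|by case/mulmx1_unit: HH|exact: vmeas_euclidean_ball|].
  rewrite muleC; congr (_ * vol _)%E; apply/seteqP.
  by split => x; rewrite /euclidean_ball/= /dotv trmx_mul mulmxA -(mulmxA x) HH mulmx1.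
by move=> x; rewrite /euclidean_ball/= /dotv linearN/= mulNmx mulmxN opprK.
Qed.

(** The cube is the test set: a dilation maps it to a cube. *)
Lemma vol_scale n (s : R) (A : set 'rV[R]_n) : 0 < s -> vmeas A ->
  vol [set x | A (s *: x)] = ((s ^- n)%:E * vol A)%E.
Proof.
move=> s0 mA.
apply: (mule_cancelr (@vol_cube_gt0 n 1 ltr01)).
  by rewrite vol_cube.
have uS : (s%:M : 'M[R]_n) \in unitmx by rewrite unitmxE det_scalar unitrX ?unitfE ?gt_eqF.
rewrite (_ : [set x | A (s *: x)] = [set x | A (x *m s%:M)]); last first.
  by apply/seteqP; split => x /=; rewrite mul_mx_scalar.
rewrite (vol_linear uS mA (@vmeas_cube n 1)); last first.
  by move=> x; split => h i; have := h i; rewrite mxE normrN.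
rewrite muleAC; congr (_ * _)%E.
rewrite (_ : [set x | _] = cube n s^-1); last first.
  apply/seteqP; split => x; rewrite /cube/= => h i; have := h i;
    rewrite mul_mx_scalar mxE normrM gtr0_norm// -ler_pdivlMl// mulr1//.
rewrite !vol_cube ?invr_ge0 ?ltW// -EFinM; congr (_%:E).
by rewrite mulr1 exprMn exprVn mulrC.
Qed.

Section balls.
Variables (n : nat) (N : 'rV[R]_n -> R).
Hypothesis hN : is_norm N.

Definition nball (v : 'rV[R]_n) (r : R) : set 'rV[R]_n := [set x | N (x - v) <= r].

Lemma nball0 : nball 0 1 = unit_ball N.
Proof. by apply/seteqP; split => x; rewrite /nball/unit_ball/= subr0. Qed.

Lemma vmeas_nball v r : vmeas (nball v r).
Proof.
apply: vmeas_le; apply: (measurable_is_norm hN).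
apply: vmeas_mapD; [exact: vmeas_rowt|exact: vmeas_map_cst].
Qed.

Lemma nball_translate v w r : nball v r = [set x | nball w r (x + (w - v))].
Proof.
by apply/seteqP; split => x; rewrite /nball/= addrA addrAC addrK.
Qed.

Lemma vol_nball v r : 0 < r -> vol (nball v r) = ((r ^+ n)%:E * vol (unit_ball N))%E.
Proof.
move=> r0; rewrite (nball_translate v 0) vol_translate; last exact: vmeas_nball.
rewrite (_ : nball 0 r = [set x | unit_ball N (r^-1 *: x)]).
  rewrite vol_scale ?invr_gt0//; first by rewrite exprVn invrK.
  by rewrite -nball0; exact: vmeas_nball.
apply/seteqP; split => x; rewrite /nball/unit_ball/= subr0 is_normZ// gtr0_norm ?invr_gt0//;
  by rewrite ler_pdivrMl// mulr1.
Qed.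

Lemma vol_unit_ball_gt0 : (0 < vol (unit_ball N))%E.
Proof.
have [K K0 NK] := is_norm_le_norm hN.
apply: (lt_le_trans (@vol_cube_gt0 n K^-1 _)); first by rewrite invr_gt0.
apply: le_vol => [||x]; [exact: vmeas_cube|rewrite -nball0; exact: vmeas_nball|].
rewrite /cube/unit_ball/= => xa.
by rewrite (le_trans (NK _))// -ler_pdivlMl// mulr1 norm_le_coord// invr_ge0 ltW.
Qed.

Lemma vol_unit_ball_fin : vol (unit_ball N) \is a fin_num.
Proof.
rewrite ge0_fin_numE ?vol_ge0//.
have [c c0 Nc] := norm_le_is_norm hN.
apply: (@le_lt_trans _ _ (vol (cube n c))); last by rewrite vol_cube ?ltW// ltry.
apply: le_vol => [||x]; [rewrite -nball0; exact: vmeas_nball|exact: vmeas_cube|].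
rewrite /unit_ball/= => xa i.
by rewrite (le_trans (coord_le_norm _ _))// (le_trans (Nc _))// ler_piMr// ltW.
Qed.

Definition unit_ball_volume : R := fine (vol (unit_ball N)).

Lemma unit_ball_volume_gt0 : 0 < unit_ball_volume.
Proof. by rewrite fine_gt0// vol_unit_ball_gt0 -ge0_fin_numE ?vol_ge0// vol_unit_ball_fin. Qed.

End balls.
End volumes.

(** * Chords and shadows of a ball *)

Section shadow.
Context {R : realType}.
Local Notation TR := (measurableTypeR R).

Lemma dotv_ge0 n (x : 'rV[R]_n) : 0 <= dotv x x.
Proof. by rewrite dotvE sumr_ge0// => i _; rewrite -expr2 sqr_ge0. Qed.

Lemma dotv_gt0 n (x : 'rV[R]_n) : x != 0 -> 0 < dotv x x.
Proof.
move=> x0; rewrite lt_def dotv_ge0 andbT; apply: contra x0.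
rewrite dotvE psumr_eq0 => [/allP s0|i _]; last by rewrite -expr2 sqr_ge0.
apply/eqP/rowP => i; rewrite mxE; apply/eqP.
by have := s0 i (mem_index_enum _); rewrite /= mulf_eq0 orbb.
Qed.

Lemma l2norm_gt0 n (x : 'rV[R]_n) : x != 0 -> 0 < l2norm x.
Proof. by move=> x0; rewrite sqrtr_gt0 dotv_gt0. Qed.

Section orthogonal_completion.
Variables (n : nat) (x : 'rV[R]_n.+1) (Q : 'M[R]_(n, n.+1)).
Hypotheses (x0 : x != 0) (xQ : hyperplane_frame x Q).

Definition direction : 'rV[R]_n.+1 := (l2norm x)^-1 *: x.

Lemma directionK : l2norm x *: direction = x.
Proof. by rewrite scalerA divff ?scale1r// gt_eqF// l2norm_gt0. Qed.

Lemma direction_neq0 : direction != 0.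
Proof. by rewrite scaler_eq0 negb_or x0 invr_eq0 gt_eqF// l2norm_gt0. Qed.

Definition frame_mx : 'M[R]_n.+1 := col_mx direction Q.

Lemma frame_mx_orthogonal : frame_mx *m frame_mx^T = 1%:M.
Proof.
have [QQ Qx] := xQ.
have Qe : Q *m direction^T = 0 by rewrite linearZ/= -scalemxAr Qx scaler0.
rewrite /frame_mx [in X in _ *m X](@tr_col_mx R 1 n n.+1).
rewrite [LHS](@mul_col_row R 1 n n.+1 1 n) QQ Qe.
have -> : direction *m Q^T = 0 by rewrite -[LHS]trmxK trmx_mul trmxK Qe trmx0.
have -> : direction *m direction^T = 1%:M.
  apply/matrixP => i j; rewrite !ord1 -[LHS]/(dotv _ _) dotvE.
  rewrite (eq_bigr (fun i => (l2norm x)^-1 ^+ 2 * (x 0 i * x 0 i))) => [|k _].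
    rewrite -mulr_sumr -dotvE exprVn sqr_sqrtr ?dotv_ge0//.
    by rewrite mulVf ?mxE// gt_eqF// dotv_gt0.
  by rewrite !mxE; ring.
by rewrite [RHS](@scalar_mx_block R 1 n).
Qed.

Lemma rowc_frame_mx s u : rowc s u *m frame_mx = s *: direction + u *m Q.
Proof. by rewrite /rowc/frame_mx [LHS](@mul_row_col R 1 1 n n.+1) mul_scalar_mx. Qed.

End orthogonal_completion.

Section chords.
Variables (n : nat) (N : 'rV[R]_n.+1 -> R) (x : 'rV[R]_n.+1) (Q : 'M[R]_(n, n.+1)).
Hypotheses (hN : is_norm N) (x0 : x != 0) (xQ : hyperplane_frame x Q).

Let e := direction x.
Let l := l2norm x.

Definition chord (u : 'rV[R]_n) : set R := [set s | N (s *: e + u *m Q) <= 1].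

Definition shadow : set 'rV[R]_n := [set u | chord u !=set0].

(** The shadow is the projection of the ball, read in the coordinates that the
    frame Q gives to the hyperplane. *)
Lemma projection_shadow :
  [set u | (proj_hyperplane x @` unit_ball N) (u *m Q)] = shadow.
Proof.
have [QQ Qx] := xQ; have xx := dotv_gt0 x0.
apply/seteqP; split => u /=.
  move=> [y yB yu]; exists (dotv x y / dotv x x * l).
  by rewrite /chord/= -scalerA directionK// -yu addrC subrK.
move=> [s hs]; exists (s *: e + u *m Q) => //; rewrite /proj_hyperplane.
have -> : s *: e = (s / l) *: x by rewrite /e /direction scalerA.
have -> : dotv x ((s / l) *: x + u *m Q) = s / l * dotv x x.
  rewrite /dotv linearD/= linearZ/= mulmxDr -scalemxAr trmx_mul mulmxA.
  have -> : x *m Q^T = 0 by rewrite -[LHS]trmxK trmx_mul trmxK Qx trmx0.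
  by rewrite mul0mx addr0 mxE.
by rewrite mulfK ?gt_eqF// addrAC subrr add0r.
Qed.

Lemma chord_bound u : exists M : R, forall s, N (s *: e + u *m Q) <= 2 -> `|s| <= M.
Proof.
have e0 : 0 < N e by rewrite is_norm_gt0// direction_neq0.
exists ((2 + N (u *m Q)) / N e) => s hs; rewrite ler_pdivlMr// -is_normZ//.
rewrite -{1}(addrK (u *m Q) (s *: e)) (le_trans (is_norm_triangle hN _ _))//.
by rewrite is_normN// lerD2r.
Qed.

(** Compactness: if the line comes arbitrarily close to the unit ball, it meets
    it, since N attains its minimum on the bounded part of the line. *)
Lemma chord_closed u : (forall k, exists s, N (s *: e + u *m Q) < 1 + k.+1%:R^-1) ->
  chord u !=set0.
Proof.
move=> hk; pose g s := N (s *: e + u *m Q).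
have e0 : 0 < N e by rewrite is_norm_gt0// direction_neq0.
have [M hM] := chord_bound u.
have near1 k : 1 + k.+1%:R^-1 <= 2 :> R.
  by rewrite -[2]/(1 + 1) lerD2l invf_le1 ?ltr0n// ler1n.
have M0 : - M <= M.
  have [s /ltW hs] := hk 0; have := hM s (le_trans hs (near1 0)).
  by have := normr_ge0 s; lra.
have cg : continuous g.
  move=> s; apply/cvgrPdist_lt => d d0; have := nbhsx_ballx s (d / N e) (divr_gt0 d0 e0).
  apply: filterS => t; rewrite -ball_normE/= ltr_pdivlMr// -is_normZ//.
  apply: le_lt_trans; rewrite scalerBl -(addrKA (u *m Q)) [in leRHS](addrC (u *m Q)).
  exact: (is_norm_dist hN).
have [c _ cmin] := EVT_min M0 (continuous_subspaceT cg).
exists c; rewrite /chord/= -/(g c); apply/ler_addgt0Pr => d d0.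
have [k kd] := ltr_add_invr (y := 0) (x := d) d0; rewrite add0r in kd.
have [s hs] := hk k.
rewrite (le_trans (cmin s _))//; last first.
  by rewrite (le_trans (ltW hs))// lerD2l ltW.
by rewrite in_itv/= -ler_norml hM// (le_trans (ltW hs)).
Qed.

(** By [chord_closed] and density, a line meets the ball if and only if for each k
    it has a rational point where N is below 1 + 1/(k+1), which is a countable
    condition. *)
Lemma vmeas_shadow : vmeas shadow.
Proof.
have e0 : 0 < N e by rewrite is_norm_gt0// direction_neq0.
pose F k (q : rat) : set (n.-tuple TR) :=
  (fun t => N (ratr q *: e + rowt t *m Q)) @^-1` `]-oo, 1 + k.+1%:R^-1[%classic.
rewrite /vmeas (_ : _ @^-1` _ = \bigcap_k \bigcup_q F k q).
  apply: bigcap_measurable => // k _; apply: bigcupT_measurable_rat => q.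
  rewrite /F -[X in measurable X]setTI.
  have : measurable_fun setT (fun t : n.-tuple TR => N (ratr q *: e + rowt t *m Q) : TR).
    apply: (measurable_is_norm hN); apply: vmeas_mapD; first exact: vmeas_map_cst.
    by apply: vmeas_map_mulmx; exact: vmeas_rowt.
  by apply.
apply/seteqP; split => t /=.
  move=> [s hs] k _.
  have [q] := @rat_in_itvoo R s (s + k.+1%:R^-1 / N e) ltac:(by rewrite ltrDl divr_gt0).
  rewrite in_itv/= => /andP[sq qs]; exists q => //.
  rewrite /F/= in_itv/= -[ratr q](subrK s) scalerDl -addrA.
  rewrite (le_lt_trans (is_norm_triangle hN _ _))//.
  apply: (@le_lt_trans _ _ (N ((ratr q - s) *: e) + 1)); first by rewrite lerD2l.
  by rewrite addrC ltrD2l is_normZ// -ltr_pdivlMr// gtr0_norm ?subr_gt0// ltrBlDl.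
move=> h; apply: chord_closed => k; have [q _] := h k I.
by rewrite /F/= in_itv/= => hq; exists (ratr q).
Qed.

Lemma shadow_bounded : exists M : R, 0 <= M /\ shadow `<=` @cube R n M.
Proof.
have [QQ Qx] := xQ.
have [c c0 Nc] := norm_le_is_norm hN.
pose M := \sum_(i < n) \sum_j c * `|Q i j|.
have M0 i : 0 <= \sum_j c * `|Q i j|.
  by rewrite sumr_ge0// => j _; rewrite mulr_ge0// ltW.
exists M; split; first by rewrite sumr_ge0.
move=> u [s hs] i; pose y := s *: e + u *m Q.
have -> : u = y *m Q^T.
  rewrite /y mulmxDl -mulmxA QQ mulmx1 -scalemxAl -[e *m _]trmxK trmx_mul trmxK.
  by rewrite [e^T]linearZ/= -scalemxAr Qx scaler0 trmx0 scaler0 add0r.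
rewrite mxE (le_trans (ler_norm_sum _ _ _))//.
rewrite (@le_trans _ _ (\sum_j c * `|Q i j|))//.
  apply: ler_sum => j _; rewrite [Q^T _ _]mxE normrM ler_wpM2r//.
  rewrite (le_trans (coord_le_norm _ _))// (le_trans (Nc _))//.
  by rewrite ler_piMr// ltW.
by rewrite /M (bigD1 i)//= lerDl sumr_ge0.
Qed.

Lemma vol_shadow_fin : vol shadow \is a fin_num.
Proof.
have [M [M0 sM]] := shadow_bounded.
rewrite ge0_fin_numE ?vol_ge0// (@le_lt_trans _ _ (vol (@cube R n M)))//.
  by apply: le_vol => //; [exact: vmeas_shadow|exact: vmeas_cube].
by rewrite vol_cube// ltry.
Qed.

Lemma chord_convex u s t a : chord u s -> chord u t -> s <= a <= t -> chord u a.
Proof.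
move=> hs ht /andP[sa at_].
have [st|st] := eqVneq s t.
  by have -> : a = s by apply/eqP; rewrite eq_le sa st at_.
have ts : 0 < t - s by rewrite subr_gt0 lt_neqAle st (le_trans sa).
pose w := (a - s) / (t - s).
have w01 : 0 <= w <= 1.
  apply/andP; split; first by rewrite divr_ge0 ?(ltW ts)// subr_ge0.
  by rewrite /w ler_pdivrMr// mul1r lerB.
have aE : a = (1 - w) * s + w * t.
  by rewrite /w; field; rewrite gt_eqF.
rewrite /chord/= (_ : _ + _ = (1 - w) *: (s *: e + u *m Q) + w *: (t *: e + u *m Q)).
  rewrite (le_trans (is_norm_triangle hN _ _))// !is_normZ// !ger0_norm; try lra.
  move: hs ht; rewrite /chord/= => hs ht; nra.
rewrite !scalerDr !scalerA addrACA -!scalerDl -aE; congr (_ + _).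
by rewrite subrK scale1r.
Qed.

(** By convexity, a point of the shifted chord outside the chord lies to the right
    of it, hence in the interval of length l that begins at its right end. *)
Lemma measure_shifted_chord u : measurable [set s | chord u (s - l) /\ ~ chord u s] ->
  (@lebesgue_measure R [set s | chord u (s - l)%R /\ ~ chord u s] <=
   l%:E * (\1_shadow u)%:E)%E.
Proof.
move=> mS; have l0 : 0 < l by exact: l2norm_gt0.
rewrite indicE; have [us|us] := pselect (shadow u); last first.
  rewrite memNset// mule0 (_ : [set s | _] = set0) ?measure0//.
  by apply/seteqP; split => s //= [hs _]; apply: us; exists (s - l).
rewrite mem_set// mule1.
have [M hM] := chord_bound u.
have hs : has_sup (chord u).
  split => //; exists M => s; rewrite /chord/= => hs.
  by rewrite (le_trans (ler_norm _))// hM// (le_trans hs)// ler1n.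
pose b := sup (chord u).
apply: (@le_trans _ _ (@lebesgue_measure R `[b, b + l]%classic)); last first.
  by rewrite lebesgue_measure_itv/= lte_fin ltrDl l0 -EFinD addrAC subrr add0r.
apply: le_measure; rewrite ?inE// => s [hs1 hs2]; rewrite /= in_itv/=.
rewrite -lerBlDr; apply/andP; split; last first.
  exact: (ub_le_sup hs.2 hs1).
apply: (ge_sup hs.1).
move=> j hj; rewrite leNgt; apply/negP => sj; apply: hs2.
by apply: (chord_convex hs1 hj); rewrite (ltW sj) andbT; lra.
Qed.

(** In coordinates adapted to x, Tonelli reduces the estimate to the chords. *)
Lemma vol_shifted_nball :
  (vol (nball N x 1 `\` nball N 0 1) <= l%:E * vol shadow)%E.
Proof.
have mA : vmeas (nball N x 1 `\` nball N 0 1).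
  by apply: measurableD; exact: vmeas_nball.
rewrite -(vol_orthogonal (frame_mx_orthogonal x0 xQ) mA).
set A := [set y | _].
have mA' : vmeas A.
  apply: (vmeas_preimage (h := fun t => rowt t *m frame_mx x Q) _ mA).
  by apply: vmeas_map_mulmx; exact: vmeas_rowt.
rewrite vol_snoc//.
have secE u : [set s | A (rowc s u)] = [set s | chord u (s - l) /\ ~ chord u s].
  apply/seteqP; split => s; rewrite /A/nball/chord/= rowc_frame_mx subr0 scalerBl.
    by rewrite -/e directionK// addrAC.
  by rewrite directionK// addrAC.
have msec (u : n.-tuple TR) : measurable [set s | chord (rowt u) (s - l) /\ ~ chord (rowt u) s].
  rewrite -secE; apply: (vmeas_preimage (h := fun s => rowc s (rowt u)) _ mA').
  by apply: vmeas_rowc; [exact: measurable_id|exact: vmeas_map_cst].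
have -> : (l%:E * vol shadow =
    \int[lebesgue_tuple n]_u (l%:E * (\1_(@rowt R n @^-1` shadow) u)%:E))%E.
  rewrite ge0_integralZl//.
  - by rewrite integral_indic// ?setIT//; exact: vmeas_shadow.
  - by apply/measurable_EFinP; apply: measurable_indic; exact: vmeas_shadow.
  - by rewrite lee_fin ltW// l2norm_gt0.
apply: ge0_le_integral => //.
- have mA2 : measurable [set p : TR * n.-tuple TR | A (rowc p.1 (rowt p.2))].
    apply: (vmeas_preimage (h := fun p => rowc p.1 (rowt p.2)) _ mA').
    apply: vmeas_rowc; first exact: measurable_fst.
    by apply: (vmeas_map_comp (g := snd) (@vmeas_rowt R n)); exact: measurable_snd.
  have := measurable_fun_ysection (@lebesgue_measure R) mA2.
  congr measurable_fun; apply/funext => u /=; congr lebesgue_measure.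
  by apply/seteqP; split => s; rewrite /ysection/= inE.
- apply: measurable_funeM; apply/measurable_EFinP; apply: measurable_indic.
  exact: vmeas_shadow.
- move=> u _; rewrite secE; apply: le_trans (measure_shifted_chord (msec u)) _.
  by rewrite !indicE.
Qed.

End chords.

Lemma polar_projection_norm_ge0 n (N : 'rV[R]_n -> R) (x : 'rV[R]_n) :
  0 <= polar_projection_norm N x.
Proof. by rewrite /polar_projection_norm mulr_ge0 ?sqrtr_ge0// fine_ge0// vol_ge0. Qed.

Section translation_bound.
Variables (n : nat) (N : 'rV[R]_n.+1 -> R).
Hypothesis hN : is_norm N.

Lemma vol_nball_diff (x : 'rV[R]_n.+1) :
  (vol (nball N x 1 `\` nball N 0 1) <= (polar_projection_norm N x)%:E)%E.
Proof.
have [->|x0] := eqVneq x 0.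
  by rewrite setDv volE preimage_set0 measure0 lee_fin polar_projection_norm_ge0.
rewrite /polar_projection_norm /vol_hyperplane.
have xQ : hyperplane_frame x (xget 0 [set Q | hyperplane_frame x Q]).
  by have [Q xQ] := exists_hyperplane_frame x; exact: (@xgetPex _ 0 [set Q | _] (ex_intro _ Q xQ)).
rewrite (projection_shadow N x0 xQ) EFinM fineK; last exact: (vol_shadow_fin hN x0 xQ).
rewrite muleC; exact: vol_shifted_nball.
Qed.

End translation_bound.
End shadow.

(** * Comparing balls by the polar projection norm *)

Section polar_projection.
Context {R : realType}.
Local Notation TR := (measurableTypeR R).
Variables (n : nat) (N : 'rV[R]_n.+1 -> R).
Hypothesis hN : is_norm N.
Implicit Types x y : 'rV[R]_n.+1.

Lemma dotvZl (c : R) x y : dotv (c *: x) y = c * dotv x y.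
Proof. by rewrite !dotvE mulr_sumr; apply: eq_bigr => i _; rewrite mxE mulrA. Qed.

Lemma dotvZr (c : R) x y : dotv x (c *: y) = c * dotv x y.
Proof. by rewrite !dotvE mulr_sumr; apply: eq_bigr => i _; rewrite mxE mulrCA. Qed.

Lemma polar_projection_normZ (c : R) x : c != 0 ->
  polar_projection_norm N (c *: x) = `|c| * polar_projection_norm N x.
Proof.
move=> c0; rewrite /polar_projection_norm.
have -> : l2norm (c *: x) = `|c| * l2norm x.
  rewrite /l2norm dotvZl dotvZr mulrA -expr2.
  by rewrite sqrtrM ?sqr_ge0// sqrtr_sqr.
have -> : vol_hyperplane (c *: x) (proj_hyperplane (c *: x) @` unit_ball N) =
    vol_hyperplane x (proj_hyperplane x @` unit_ball N).
  have -> : proj_hyperplane (c *: x) = proj_hyperplane x.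
    apply/funext => y; rewrite /proj_hyperplane scalerA; congr (_ - _ *: _).
    rewrite dotvZl dotvZl dotvZr.
    have [->|d0] := eqVneq (dotv x x) 0; first by rewrite !mulr0 invr0 !mulr0 mul0r.
    by field; rewrite c0 d0.
  rewrite /vol_hyperplane (_ : hyperplane_frame (c *: x) = hyperplane_frame x)//.
  apply/funext => Q; apply/propext; rewrite /hyperplane_frame linearZ/= -scalemxAr.
  split => -[-> Qx]; split => //; last by rewrite Qx scaler0.
  by rewrite -[LHS]scale1r -(mulVf c0) -scalerA Qx scaler0.
by ring.
Qed.

(** The norm that bounds the extension, up to the constant. *)
Definition rho x := polar_projection_norm N x / unit_ball_volume N.

Lemma rho_ge0 x : 0 <= rho x.
Proof. by rewrite divr_ge0 ?polar_projection_norm_ge0// ltW// unit_ball_volume_gt0. Qed.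

Lemma rhoC x y : rho (x - y) = rho (y - x).
Proof.
by rewrite /rho -opprB -scaleN1r polar_projection_normZ ?normrN1 ?mul1r// oppr_eq0 oner_eq0.
Qed.

(** Translating the unit ball by more than twice its size makes it disjoint from
    itself, so that the translation bound controls its whole volume. *)
Lemma is_norm_le_rho x : N x <= 3 * rho x.
Proof.
have [->|x0] := eqVneq x 0; first by rewrite is_norm0// mulr_ge0// rho_ge0.
have Nx := is_norm_gt0 hN x0.
pose c := 3 / N x; have c0 : 0 < c by rewrite divr_gt0.
have := vol_nball_diff hN (c *: x).
have -> : nball N (c *: x) 1 `\` nball N 0 1 = nball N (c *: x) 1.
  apply/seteqP; split => [z []//|z]; rewrite /nball/= subr0 => zx; split => // z1.
  have := is_norm_split hN (c *: x) z 0.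
  rewrite !subr0 is_normC// is_normZ// gtr0_norm// divfK ?gt_eqF// => h.
  have : N (c *: x) <= N (c *: x - z) + N z by rewrite -{1}(subrK z (c *: x)) is_norm_triangle.
  by rewrite is_normC// is_normZ// gtr0_norm// divfK ?gt_eqF//; lra.
rewrite vol_nball// expr1n mul1e -(fineK (vol_unit_ball_fin hN)) lee_fin.
rewrite polar_projection_normZ ?gt_eqF// gtr0_norm// => h.
rewrite /rho mulrA ler_pdivlMr ?unit_ball_volume_gt0// mulrC -ler_pdivlMr//.
by rewrite mulrAC.
Qed.

(** Rescaled to radius 1, this is [vol_nball_diff] for (x - y) / r. *)
Lemma vol_nball_setD x y (r : R) : 0 < r ->
  (vol (nball N x r `\` nball N y r) <= (r ^+ n * polar_projection_norm N (x - y))%:E)%E.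
Proof.
move=> r0; pose v := r^-1 *: (x - y); pose D := nball N v 1 `\` nball N 0 1.
have mD : vmeas D by apply: measurableD; exact: vmeas_nball.
have scaleE w z : N (r^-1 *: (z - y) - r^-1 *: (w - y)) <= 1 <-> N (z - w) <= r.
  rewrite -scalerBr opprB addrA subrK is_normZ// gtr0_norm ?invr_gt0//.
  by rewrite ler_pdivrMl// mulr1.
have -> : nball N x r `\` nball N y r =
    [set z | [set z' | D (r^-1 *: z')] (z - y)].
  apply/seteqP; split => z; rewrite /D/v/nball/=; have := scaleE x z; have := scaleE y z;
    by rewrite subrr scaler0 => -> ->.
rewrite vol_translate; last first.
  apply: (vmeas_preimage (h := fun t => r^-1 *: rowt t) _ mD) => i.
  rewrite (_ : (fun _ => _) = (fun t : n.+1.-tuple TR => r^-1 * rowt t 0 i)).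
    by apply: measurable_funM; [exact: measurable_cst|exact: vmeas_rowt].
  by apply/funext => t; rewrite mxE.
rewrite vol_scale ?invr_gt0// exprVn invrK.
apply: (le_trans (lee_wpmul2l _ (vol_nball_diff hN v))).
  by rewrite lee_fin exprn_ge0// ltW.
rewrite -EFinM lee_fin /v polar_projection_normZ ?invr_eq0 ?gt_eqF//.
rewrite gtr0_norm ?invr_gt0// exprS [leLHS](_ : _ = r ^+ n * polar_projection_norm N (x - y))//.
by field; rewrite gt_eqF.
Qed.

Definition nball_volume (r : R) : R := r ^+ n.+1 * unit_ball_volume N.

Lemma fine_vol_nball x r : 0 < r -> fine (vol (nball N x r)) = nball_volume r.
Proof. by move=> r0; rewrite vol_nball// -(fineK (vol_unit_ball_fin hN)) -EFinM. Qed.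

Lemma vol_nball_fin x r : 0 < r -> (vol (nball N x r) < +oo)%E.
Proof.
by move=> r0; rewrite vol_nball// -(fineK (vol_unit_ball_fin hN)) -EFinM ltry.
Qed.

Lemma nball_volume_gt0 r : 0 < r -> 0 < nball_volume r.
Proof. by move=> r0; rewrite mulr_gt0 ?exprn_gt0// unit_ball_volume_gt0. Qed.

Lemma fine_vol_nball_setD x y (r : R) : 0 < r ->
  fine (vol (nball N x r `\` nball N y r)) / nball_volume r <= rho (x - y) / r.
Proof.
move=> r0; have h := vol_nball_setD x y r0.
rewrite ler_pdivrMr ?nball_volume_gt0//.
have -> : rho (x - y) / r * nball_volume r = r ^+ n * polar_projection_norm N (x - y).
  rewrite /rho /nball_volume exprS; field.
  by rewrite !gt_eqF ?unit_ball_volume_gt0.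
rewrite -lee_fin fineK// ge0_fin_numE ?vol_ge0//.
by rewrite (le_lt_trans h)// ltry.
Qed.

End polar_projection.

Section fibres.
Context d (T : measurableType d) (R : realType) (mu : {measure set T -> \bar R}).
Variable kappa : T -> nat.
Hypothesis mk : forall j, measurable (kappa @^-1` [set j]).
Local Notation cell j := (kappa @^-1` [set (j : nat)]).

Lemma sum_measure_fibres (A : set T) J : measurable A -> (mu A < +oo)%E ->
  (forall t, A t -> (kappa t < J)%N) ->
  \sum_(j < J) fine (mu (A `&` cell j)) = fine (mu A).
Proof.
move=> mA fA kJ.
have finI (j : 'I_J) : mu (A `&` cell j) \is a fin_num.
  by rewrite ge0_fin_numE// (le_lt_trans _ fA)// measureIl.
rewrite sum_fine//; congr fine.
rewrite -(measure_bigsetU_ord mu xpredT (F := fun j : 'I_J => A `&` cell j)).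
- congr (mu _); rewrite -bigcup_seq; apply/seteqP; split => t.
    by move=> [j _ []].
  move=> At; exists (Ordinal (kJ t At)) => //=.
  by rewrite mem_index_enum.
- by move=> j; exact: measurableI.
- move=> i j _ _ [t [[_ /= ti] [_ tj]]]; apply/val_inj; exact: etrans (esym ti) tj.
Qed.

Lemma dist_measure_setI (A B E : set T) : measurable A -> measurable B -> measurable E ->
  (mu A < +oo)%E -> (mu B < +oo)%E ->
  `|fine (mu (A `&` E)) - fine (mu (B `&` E))| <=
    fine (mu ((A `\` B) `&` E)) + fine (mu ((B `\` A) `&` E)).
Proof.
move=> mA mB mE fA fB.
have half (C D : set T) : measurable C -> measurable D -> (mu C < +oo)%E ->
    fine (mu (C `&` E)) = fine (mu ((C `\` D) `&` E)) + fine (mu ((C `&` D) `&` E)).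
  move=> mC mD fC.
  have sub (X : set T) : measurable X -> X `<=` C -> mu X \is a fin_num.
    move=> mX XC; rewrite ge0_fin_numE//; apply: le_lt_trans fC.
    by apply: le_measure; rewrite ?inE.
  rewrite (@measureDI _ _ _ mu (C `&` E) D)//; last exact: measurableI.
  have -> : (C `&` E) `\` D = (C `\` D) `&` E by rewrite !setDE setIAC.
  have -> : C `&` E `&` D = C `&` D `&` E by rewrite setIAC.
  rewrite fineD//; apply: sub.
  - by apply: measurableI => //; exact: measurableD.
  - by move=> t [[]].
  - by apply: measurableI => //; exact: measurableI.
  - by move=> t [[]].
rewrite (half A B)// (half B A)// (setIC B A) opprD addrACA subrr addr0.
by rewrite (le_trans (ler_normB _ _))// !ger0_norm// fine_ge0.
Qed.

(** On each fibre the masses of A and B differ by at most the masses there of the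
    two set differences, and these add up over the fibres. *)
Lemma sum_dist_measure_fibres (A B : set T) J : measurable A -> measurable B ->
  (mu A < +oo)%E -> (mu B < +oo)%E ->
  (forall t, A t \/ B t -> (kappa t < J)%N) ->
  \sum_(j < J) `|fine (mu (A `&` cell j)) - fine (mu (B `&` cell j))| <=
    fine (mu (A `\` B)) + fine (mu (B `\` A)).
Proof.
move=> mA mB fA fB kJ.
have mAB := measurableD mA mB; have mBA := measurableD mB mA.
apply: (@le_trans _ _ (\sum_(j < J) (fine (mu ((A `\` B) `&` cell j)) +
                                     fine (mu ((B `\` A) `&` cell j))))).
  by apply: ler_sum => j _; exact: dist_measure_setI.
rewrite big_split/= !sum_measure_fibres//.
- by rewrite (le_lt_trans _ fB)// le_measure ?inE// => t [].
- by move=> t [Bt _]; apply: kJ; right.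
- by rewrite (le_lt_trans _ fA)// le_measure ?inE// => t [].
- by move=> t [At _]; apply: kJ; left.
Qed.

End fibres.

(** * Averages over balls of a fixed radius *)

Section distance.
Context {R : realType} (n : nat) (N : 'rV[R]_n -> R) (D : set 'rV[R]_n).
Hypotheses (hN : is_norm N) (D0 : D !=set0).
Implicit Types x y : 'rV[R]_n.

Definition ndist x : R := inf [set N (x - a) | a in D].

Let has_inf_dist x : has_inf [set N (x - a) | a in D].
Proof.
split; first by have [a Da] := D0; exists (N (x - a)), a.
by exists 0 => _ [a _ <-]; exact: is_norm_ge0.
Qed.

Lemma ndist_le x a : D a -> ndist x <= N (x - a).
Proof.
by move=> Da; apply: ge_inf; [exact: (has_inf_dist x).2|exists a]. Qed.

Lemma ndist_ge0 x : 0 <= ndist x.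
Proof.
by apply: lb_le_inf; [exact: (has_inf_dist x).1|move=> _ [a _ <-]; exact: is_norm_ge0].
Qed.

Lemma ndist_adherent x e : 0 < e -> exists2 a, D a & N (x - a) < ndist x + e.
Proof.
move=> e0; have [_ [a Da <-] ae] := inf_adherent e0 (has_inf_dist x).
by exists a.
Qed.

Lemma ndist_lipschitz x y : ndist x <= ndist y + N (x - y).
Proof.
rewrite -lerBlDr; apply: lb_le_inf; first exact: (has_inf_dist y).1.
move=> _ [a Da <-]; rewrite lerBlDr (le_trans (ndist_le x Da))// [leRHS]addrC.
exact: (is_norm_split hN).
Qed.

End distance.

Section grid_cells.
Context {R : realType} (n : nat).
Local Notation TR := (measurableTypeR R).
Variable e : R.
Hypothesis e0 : 0 < e.
Implicit Types z : 'rV[R]_n.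

Definition grid z : 'rV[int]_n := \row_i Num.floor (z 0 i / e).

Definition grid_corner (v : 'rV[int]_n) : 'rV[R]_n := \row_i ((v 0 i)%:~R * e).

Lemma grid_corner_near z i : `|(z - grid_corner (grid z)) 0 i| <= e.
Proof.
rewrite !mxE; set m := Num.floor _.
have /andP[ml mr] : m%:~R <= z 0 i / e < (m + 1)%:~R by rewrite floor_itv ?num_real.
rewrite ler_pdivlMr// in ml; rewrite ltr_pdivrMr// intrD mulrDl mul1r in mr.
by rewrite ger0_norm ?subr_ge0// lerBlDl ltW.
Qed.

Lemma vmeas_grid (v : 'rV[int]_n) : vmeas [set z | grid z = v].
Proof.
rewrite /vmeas (_ : _ @^-1` _ = \bigcap_(i in [set: 'I_n])
   ((fun t : n.-tuple TR => rowt t 0 i * e^-1) @^-1` `[(v 0 i)%:~R, (v 0 i + 1)%:~R[%classic)).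
  apply: fin_bigcap_measurable => // i _.
  rewrite -[X in measurable X]setTI.
  have : measurable_fun setT (fun t : n.-tuple TR => rowt t 0 i * e^-1 : TR).
    by apply: measurable_funM; [exact: vmeas_rowt|exact: measurable_cst].
  by apply.
apply/seteqP; split => t /=.
  by move=> <- i _ /=; rewrite in_itv/= mxE floor_itv ?num_real.
move=> h; apply/rowP => i; rewrite mxE; apply: floor_def.
by have := h i I; rewrite /= in_itv.
Qed.

Lemma grid_finite (M : R) : exists J, forall z, (forall i, `|z 0 i| <= M) ->
  (pickle (grid z) < J)%N.
Proof.
pose m := (Num.trunc (M / e)).+1.
pose decode (u : {ffun 'I_n -> 'I_(m + m).+1}) : 'rV[int]_n :=
  \row_i ((u i : nat)%:Z - m%:Z).
exists (\max_u pickle (decode u)).+1 => z hz; rewrite ltnS.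
suff [u <-] : exists u, decode u = grid z by exact: leq_bigmax.
exists [ffun i => inord (absz (grid z 0 i + m%:Z))].
apply/rowP => i; rewrite [LHS]mxE ffunE.
have [gl gr] : (- m%:Z <= grid z 0 i)%R /\ (grid z 0 i < m%:Z)%R.
  have ym : `|z 0 i / e| < m%:R.
    rewrite normrM [X in _ * X]gtr0_norm ?invr_gt0//.
    by rewrite (le_lt_trans _ (truncnS_gt _))// ler_pM2r ?invr_gt0.
  move: ym; rewrite ltr_norml mxE real_floor_lt_int ?num_real// => /andP[h1 h2]; split => //.
  by rewrite real_floor_ge_int ?num_real// rmorphN ltW.
by rewrite inordK; lia.
Qed.

End grid_cells.

Section ball_averages.
Context {R : realType} (n : nat) (N : 'rV[R]_n.+1 -> R).
Hypothesis hN : is_norm N.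
Variables (Z : normedModType R) (D : set 'rV[R]_n.+1) (f : 'rV[R]_n.+1 -> Z).
Hypotheses (D0 : D !=set0)
  (fD : forall x y, D x -> D y -> `|f x - f y| <= N (x - y)).
Implicit Types x y z : 'rV[R]_n.+1.

Local Notation dist := (ndist N D).

(** The map p o kappa is an almost nearest point projection onto D that takes
    finitely many values on each ball of radius r: kappa numbers the cells of a
    grid whose cells have N-diameter of order r, and p picks a point of D almost
    nearest to the corner of a cell. *)
Lemma almost_projection r : 0 < r ->
  exists (kappa : 'rV[R]_n.+1 -> nat) (p : nat -> 'rV[R]_n.+1),
  [/\ forall j, vmeas (kappa @^-1` [set j]),
      forall x, exists J, forall z, nball N x r z -> (kappa z < J)%N,
      forall j, D (p j) &
      forall z, N (z - p (kappa z)) <= dist z + 3 * r].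
Proof.
move=> r0; have [K K0 NK] := is_norm_le_norm hN; have [c c0 Nc] := norm_le_is_norm hN.
pose e := r / K; have e0 : 0 < e by rewrite divr_gt0.
have /choice[q qP] (v : 'rV[int]_n.+1) : exists a,
    D a /\ N (grid_corner e v - a) < dist (grid_corner e v) + r.
  by have [a Da ?] := ndist_adherent hN D0 (grid_corner e v) r0; exists a.
exists (fun z => pickle (grid e z)), (fun j => q (odflt 0 (unpickle j))); split.
- move=> j; have [[v <-]|nov] := pselect (exists v : 'rV[int]_n.+1, pickle v = j).
    rewrite (_ : _ @^-1` _ = [set z | grid e z = v]); first exact: vmeas_grid.
    by apply/seteqP; split => z /= => [/(pcan_inj pickleK)|->].
  rewrite (_ : _ @^-1` _ = set0); first exact: measurable0.
  by apply/seteqP; split => z //= zj; apply: nov; exists (grid e z).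
- move=> x; have [J hJ] := @grid_finite R n.+1 e e0 (c * (r + N x)).
  exists J => z zx; apply: hJ => i.
  rewrite (le_trans (coord_le_norm _ _))// (le_trans (Nc _))// ler_pM2l//.
  by rewrite -{1}(subrK x z) (le_trans (is_norm_triangle hN _ _))// lerD2r.
- by move=> j; case: (qP (odflt 0 (unpickle j))).
move=> z; rewrite pickleK/=; set v := grid e z.
have [_ qv] := qP v.
have zv : N (z - grid_corner e v) <= r.
  rewrite (le_trans (NK _))// -ler_pdivlMl// mulrC.
  by apply: norm_le_coord => [|i]; [exact: ltW|exact: grid_corner_near].
have := is_norm_split hN (grid_corner e v) z (q v).
have := ndist_lipschitz hN D0 (grid_corner e v) z.
rewrite (is_normC hN (grid_corner e v) z); lra.
Qed.

Lemma norm_sum_weights (J : nat) (w : 'I_J -> R) (g : 'I_J -> Z) (M : R) :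
  (forall j, w j != 0 -> `|g j| <= M) ->
  `|\sum_j w j *: g j| <= (\sum_j `|w j|) * M.
Proof.
move=> hw; rewrite (le_trans (ler_norm_sum _ _ _))// mulr_suml ler_sum// => j _.
rewrite normrZ; have [->|wj] := eqVneq (w j) 0; first by rewrite normr0 !mul0r.
by rewrite ler_wpM2l// hw.
Qed.

(** A x is the average of f o p o kappa over the ball of radius r around x, for the
    almost projection p o kappa. Both bounds come from comparing with a fixed
    value f a: the weights sum to 1, and the l1-distance between the weights at x
    and at y is at most the relative volume of the symmetric difference of the
    two balls. *)
Lemma ball_average r : 0 < r -> exists A : 'rV[R]_n.+1 -> Z,
  (forall x a, D a -> `|A x - f a| <= N (x - a) + dist x + 5 * r) /\
  (forall x y, `|A x - A y| <=
     2 * rho N (x - y) / r * (2 * dist x + 2 * N (x - y) + 6 * r)).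
Proof.
move=> r0; have [kappa [p [mk kJ Dp hp]]] := almost_projection r0.
have [J hJ] := choice kJ.
pose mu := lebesgue_tuple n.+1 : {measure set _ -> \bar R}.
pose cell j : set 'rV[R]_n.+1 := kappa @^-1` [set j].
pose ball x := nball N x r.
pose w x j := fine (vol (ball x `&` cell j)) / nball_volume N r.
have V0 : 0 < nball_volume N r by exact: nball_volume_gt0.
have mball x : vmeas (ball x) by exact: vmeas_nball.
have fball x : (vol (ball x) < +oo)%E by exact: vol_nball_fin.
have w_ge0 x j : 0 <= w x j by rewrite divr_ge0 ?fine_ge0 ?vol_ge0// ltW.
have w_neq0 x j : w x j != 0 -> exists z, ball x z /\ kappa z = j.
  move=> /eqP wn; apply: contrapT => h; apply: wn; rewrite /w (_ : _ `&` _ = set0).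
    by rewrite volE preimage_set0 measure0 mul0r.
  by apply/seteqP; split => z // [zb zj]; apply: h; exists z.
have kJ' x j z : ball x z -> (J x <= j)%N -> (kappa z < j)%N.
  by move=> zx Jj; exact: leq_trans (hJ _ _ zx) Jj.
have sum_w x K : (J x <= K)%N -> \sum_(j < K) w x j = 1.
  move=> JK; rewrite -mulr_suml.
  rewrite (@sum_measure_fibres _ _ _ mu (kappa \o @rowt R n.+1) mk (@rowt R n.+1 @^-1` ball x))//.
  - by rewrite -[mu _]/(vol (ball x)) fine_vol_nball// divff// gt_eqF.
  - exact: mball.
  - exact: fball.
  - by move=> t tx; exact: (kJ' x K (rowt t) tx JK).
have sum_dw x y K : (J x <= K)%N -> (J y <= K)%N ->
    \sum_(j < K) `|w x j - w y j| <= 2 * rho N (x - y) / r.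
  move=> xK yK.
  rewrite (eq_bigr (fun j : 'I_K => `|fine (vol (ball x `&` cell j)) -
      fine (vol (ball y `&` cell j))| / nball_volume N r)); last first.
    by move=> j _; rewrite /w -mulrBl normrM [X in _ * X]gtr0_norm// invr_gt0.
  rewrite -mulr_suml.
  have h : \sum_(j < K) `|fine (vol (ball x `&` cell j)) - fine (vol (ball y `&` cell j))| <=
      fine (vol (ball x `\` ball y)) + fine (vol (ball y `\` ball x)).
    apply: (@sum_dist_measure_fibres _ _ _ mu (kappa \o @rowt R n.+1) mk
      (@rowt R n.+1 @^-1` ball x) (@rowt R n.+1 @^-1` ball y) K).
    - exact: mball.
    - exact: mball.
    - exact: fball.
    - exact: fball.
    - by move=> t [tx|ty]; [exact: kJ' _ _ _ tx xK|exact: kJ' _ _ _ ty yK].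
  rewrite ler_pdivrMr//; apply: (le_trans h).
  have := fine_vol_nball_setD hN x y r0; have := fine_vol_nball_setD hN y x r0.
  rewrite !ler_pdivrMr// rhoC// -/(ball x) -/(ball y).
  have -> : 2 * rho N (x - y) / r * nball_volume N r =
    rho N (x - y) / r * nball_volume N r + rho N (x - y) / r * nball_volume N r by ring.
  by move=> h1 h2; exact: lerD.
have p_near x a j : D a -> w x j != 0 -> `|f (p j) - f a| <= N (x - a) + dist x + 5 * r.
  move=> Da /w_neq0[z [zx <-]]; rewrite (le_trans (fD (Dp _) Da))//.
  have h1 := is_norm_split hN z (p (kappa z)) a; rewrite (is_normC hN _ z) in h1.
  have h2 := is_norm_split hN x z a.
  have h3 := ndist_lipschitz hN D0 z x.
  have := hp z; move: zx; rewrite /ball/nball/=; lra.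
pose A x := \sum_(j < J x) w x j *: f (p j).
have AE x a K : (J x <= K)%N -> A x - f a = \sum_(j < K) w x j *: (f (p j) - f a).
  move=> JK; under eq_bigr do rewrite scalerBr.
  rewrite sumrB -scaler_suml sum_w// scale1r; congr (_ - _).
  rewrite /A -!(big_mkord xpredT (fun j => w x j *: f (p j))).
  rewrite [RHS](big_cat_nat (n := J x))//=.
  rewrite [X in _ = _ + X](_ : _ = 0) ?addr0// big_nat_cond big1// => j.
  move=> /andP[/andP[Jj _] _]; have [->|] := eqVneq (w x j) 0; first by rewrite scale0r.
  by move=> /w_neq0[z [zx zj]]; have := hJ _ _ zx; rewrite zj ltnNge Jj.
exists A; split => [x a Da|x y].
  rewrite (AE x a (J x))// (le_trans (norm_sum_weights (fun j => p_near x a j Da)))//.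
  by under eq_bigr do rewrite ger0_norm//; rewrite sum_w// mul1r.
have [a Da xa] := ndist_adherent hN D0 x r0.
pose K := maxn (J x) (J y).
have -> : A x - A y = \sum_(j < K) (w x j - w y j) *: (f (p j) - f a).
  under eq_bigr do rewrite scalerBl.
  rewrite sumrB -(AE x a K) ?leq_maxl// -(AE y a K) ?leq_maxr//.
  by rewrite opprB addrA subrK.
have b0 : 0 <= 2 * dist x + 2 * N (x - y) + 6 * r.
  have := is_norm_ge0 hN (x - y); have := ndist_ge0 hN D0 x; lra.
rewrite (le_trans (norm_sum_weights (M := 2 * dist x + 2 * N (x - y) + 6 * r) _))//.
  move=> j; have [wx _|wx] := boolP (w x j != 0).
    have := p_near _ _ _ Da wx; have := is_norm_ge0 hN (x - y).
    have := ndist_ge0 hN D0 x; lra.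
  have [wy _|wy] := boolP (w y j != 0).
    have := p_near _ _ _ Da wy; have := is_norm_split hN x y a.
    have := ndist_lipschitz hN D0 y x; rewrite (is_normC hN y x); lra.
  by move: wx wy; rewrite !negbK => /eqP-> /eqP->; rewrite subrr eqxx.
by rewrite ler_wpM2r// sum_dw ?leq_maxl ?leq_maxr.
Qed.

End ball_averages.

(** * Interpolation between scales and the extension *)

Section dyadic_interpolation.
Context {R : realType}.

Lemma dyadic_scale (t : R) : 0 < t ->
  exists k : int, 2 ^ k <= t /\ t < 2 ^ (k + 1).
Proof.
move=> t0; have l2 : 0 < ln 2 :> R by rewrite ln_gt0// ltr1n.
have pE (m : int) : (2 : R) ^ m = expR (ln 2 * m%:~R).
  by rewrite -powR_intmul// /powR pnatr_eq0/= mulrC.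
exists (Num.floor (ln t / ln 2)); rewrite !pE.
have : ln t / ln 2 \is Num.real by exact: num_real.
move=> /real_floor_itv/andP[]; set m := Num.floor _ => h1 h2.
split; [rewrite -[leRHS]lnK ?posrE// ler_expR|rewrite -[ltLHS]lnK ?posrE// ltr_expR].
  by rewrite mulrC -ler_pdivlMr.
by rewrite mulrC -ltr_pdivrMr.
Qed.

Lemma exprz2D1 (k : int) : (2 : R) ^ (k + 1) = 2 * 2 ^ k.
Proof. by rewrite expfzDr ?pnatr_eq0// expr1z mulrC. Qed.

Lemma exprz2_gt0 (k : int) : 0 < (2 : R) ^ k.
Proof. by rewrite exprz_gt0. Qed.

Lemma exprz2_le (k l : int) : k <= l -> (2 : R) ^ k <= 2 ^ l.
Proof. by move=> kl; rewrite ler_weXz2l ?ler1n. Qed.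

Lemma dyadic_scale_choice : exists kk : R -> int,
  forall t, 0 < t -> 2 ^ kk t <= t /\ t < 2 ^ (kk t + 1).
Proof.
have /choice[kk hk] t : exists k : int, 0 < t -> 2 ^ k <= t /\ t < 2 ^ (k + 1) :> R.
  have [t0|t0] := ltP 0 t; last by exists 0.
  by have [k hk] := dyadic_scale t0; exists k.
by exists kk.
Qed.

Variables (kk : R -> int) (Z : normedModType R).
Hypothesis hkk : forall t, 0 < t -> 2 ^ kk t <= t /\ t < 2 ^ (kk t + 1).
Implicit Types (G H : int -> Z) (t s : R).

Definition slope t : R := t / 2 ^ kk t - 1.

Definition interpolate G t : Z :=
  G (kk t) + slope t *: (G (kk t + 1) - G (kk t)).

Lemma slope01 t : 0 < t -> 0 <= slope t <= 1.
Proof.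
move=> t0; have [h1 h2] := hkk t0; have p0 := exprz2_gt0 (kk t).
rewrite exprz2D1 in h2; rewrite /slope subr_ge0 ler_pdivlMr// mul1r h1/=.
by rewrite lerBlDr ler_pdivrMr// ltW.
Qed.

Lemma interpolate_convex G t : interpolate G t =
  (1 - slope t) *: G (kk t) + slope t *: G (kk t + 1).
Proof.
by rewrite /interpolate; move: (slope t) => w; rewrite scalerBr scalerBl scale1r addrA addrAC.
Qed.

Lemma norm_interpolate G H t (M : R) : 0 < t ->
  `|G (kk t) - H (kk t)| <= M -> `|G (kk t + 1) - H (kk t + 1)| <= M ->
  `|interpolate G t - interpolate H t| <= M.
Proof.
move=> t0 h1 h2; have /andP[] := slope01 t0.
rewrite !interpolate_convex; move: (slope t) => w w0 w1; rewrite opprD addrACA -!scalerBr.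
rewrite (le_trans (ler_normD _ _))// !normrZ ger0_norm ?subr_ge0//.
by rewrite (ger0_norm w0); nra.
Qed.

Lemma interpolate_cst (z : Z) t : interpolate (fun=> z) t = z.
Proof. by rewrite /interpolate subrr scaler0 addr0. Qed.

(** Only the scales comparable to t matter, and s < 2 t keeps t and s in the same
    dyadic interval or in adjacent ones. *)
Lemma interpolate_lipschitz G t s (M : R) : 0 < t -> t <= s -> s < 2 * t ->
  (forall k, t < 2 * 2 ^ k -> `|G (k + 1) - G k| <= M * 2 ^ k) ->
  `|interpolate G s - interpolate G t| <= M * (s - t).
Proof.
move=> t0 ts st hG; have s0 := lt_le_trans t0 ts.
have [kt tk] := hkk t0; have [ls sl] := hkk s0.
rewrite /interpolate /slope; move: (kk t) (kk s) kt tk ls sl => k l kt tk ls sl.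
have p0 := exprz2_gt0 k; rewrite exprz2D1 in tk.
have hk := hG k tk.
have kl : k <= l.
  rewrite leNgt; apply/negP => lk.
  have := @exprz2_le (l + 1) k ltac:(lia); lra.
have lk : l <= k + 1.
  rewrite leNgt; apply/negP => kl1.
  have := @exprz2_le (k + 2) l ltac:(lia).
  rewrite (_ : k + 2 = k + 1 + 1); last by lia.
  rewrite !exprz2D1; lra.
have [lE|lE] : l = k \/ l = k + 1 by lia.
  rewrite lE opprD addrACA subrr add0r -scalerBl normrZ.
  rewrite (_ : _ - _ = (s - t) / 2 ^ k); last by field; rewrite gt_eqF.
  rewrite ger0_norm; last by rewrite divr_ge0 ?subr_ge0// ltW.
  rewrite mulrAC ler_pdivrMr// (mulrC M) -mulrA ler_wpM2l ?subr_ge0//.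
(* Across a dyadic point, compare both values with the value at that point. *)
have hl : `|G (l + 1) - G l| <= M * 2 ^ l.
  by apply: hG; rewrite lE exprz2D1; lra.
have q0 := exprz2_gt0 l.
have -> : G l + (s / 2 ^ l - 1) *: (G (l + 1) - G l)
    - (G k + (t / 2 ^ k - 1) *: (G (k + 1) - G k)) =
    (s / 2 ^ l - 1) *: (G (l + 1) - G l) + (2 - t / 2 ^ k) *: (G (k + 1) - G k).
  have -> : 2 - t / 2 ^ k = 1 - (t / 2 ^ k - 1) by ring.
  have : G l = G k + (G (k + 1) - G k) by rewrite lE [RHS]addrC subrK.
  move: (G l) (G (l + 1) - G l) (G (k + 1) - G k) (s / 2 ^ l - 1) (t / 2 ^ k - 1).
  move=> g u v p c ->; rewrite scalerBl scale1r.
  by rewrite -(addrA (G k) v) opprD addrACA subrr add0r (addrC v) -addrA.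
rewrite (le_trans (ler_normD _ _))// !normrZ.
rewrite ger0_norm ?subr_ge0 ?ler_pdivlMr ?mul1r//.
rewrite [X in _ + X * _]ger0_norm ?subr_ge0 ?ler_pdivrMr ?(ltW tk)//.
apply: (@le_trans _ _ ((s / 2 ^ l - 1) * (M * 2 ^ l) + (2 - t / 2 ^ k) * (M * 2 ^ k))).
  apply: lerD; rewrite ler_wpM2l// subr_ge0.
    by rewrite ler_pdivlMr// mul1r.
  by rewrite ler_pdivrMr// ltW.
have -> : (s / 2 ^ l - 1) * (M * 2 ^ l) + (2 - t / 2 ^ k) * (M * 2 ^ k) =
    M * (s - 2 ^ l + 2 * 2 ^ k - t) by field; rewrite !gt_eqF.
rewrite lE exprz2D1 (_ : _ - _ = s - t)//; ring.
Qed.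

End dyadic_interpolation.

Section closure_extension.
Context {R : realType} (n : nat) (N : 'rV[R]_n -> R) (Z : completeNormedModType R).
Variables (D : set 'rV[R]_n) (f : 'rV[R]_n -> Z).
Hypotheses (hN : is_norm N) (D0 : D !=set0)
  (fD : forall x y, D x -> D y -> `|f x - f y| <= N (x - y)).

(** The values of f along a sequence of D converging to x form a Cauchy sequence. *)
Lemma closure_value x : ndist N D x = 0 ->
  exists z, forall a, D a -> `|z - f a| <= N (x - a).
Proof.
move=> dx.
have /choice[a_ ha] (k : nat) : exists a, D a /\ N (x - a) < k.+1%:R^-1.
  have [a Da] := ndist_adherent hN D0 x (e := k.+1%:R^-1) ltac:(by rewrite invr_gt0).
  by rewrite dx add0r; exists a.
pose u k := f (a_ k).
have ua k a : D a -> `|u k - f a| <= k.+1%:R^-1 + N (x - a).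
  move=> Da; have [Dk xk] := ha k; rewrite (le_trans (fD Dk Da))//.
  rewrite (le_trans (is_norm_split hN x _ _))// lerD2r is_normC// ltW//.
have small (e : R) : 0 < e -> \forall k \near \oo, k.+1%:R^-1 < e.
  by move=> e0; exact: (near_infty_natSinv_lt (PosNum e0)).
have uc : cauchy (u @ \oo).
  apply: cauchy_exP => e e0; have e2 : 0 < e / 2 by rewrite divr_gt0.
  have [K _ hK] := small _ e2.
  have h1 : K.+1%:R^-1 < e / 2 :> R by apply: hK => /=.
  exists (u K); suff : \forall k \near \oo, ball (u K) e (u k) by [].
  have := small _ e2; apply: filterS => k /= h2; rewrite -ball_normE/=.
  have [Dk xk] := ha k; rewrite (le_lt_trans (ua K _ Dk))// [ltRHS]splitr ltrD//.
  exact: lt_trans h2.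
have : cvg (u @ \oo) by exact: cauchy_cvg uc.
move: (lim _) => z uz; exists z => a Da; apply/ler_addgt0Pr => e e0.
have e2 : 0 < e / 2 by rewrite divr_gt0.
have hz : \forall k \near \oo, `|z - u k| < e / 2 by exact: (cvgrPdist_lt _ _).1 uz _ e2.
have [k [h1 h2]] : exists k, `|z - u k| < e / 2 /\ k.+1%:R^-1 < e / 2 :> R.
  have [K _ hK] := filterI hz (small _ e2).
  by exists K; apply: hK => /=.
move: (k.+1%:R^-1) h2 (ua k a Da) => c h2 h3.
have := ler_distD (u k) z (f a); lra.
Qed.

End closure_extension.

Section extension.
Context {R : realType} (n : nat) (N : 'rV[R]_n.+1 -> R) (Z : completeNormedModType R).
Variables (D : set 'rV[R]_n.+1) (f : 'rV[R]_n.+1 -> Z).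
Hypotheses (hN : is_norm N) (D0 : D !=set0)
  (fD : forall x y, D x -> D y -> `|f x - f y| <= N (x - y)).
Implicit Types x y : 'rV[R]_n.+1.

Local Notation dist := (ndist N D).

(** The first bound holds because only radii at most 2 dist x enter F x when
    dist x > 0, and dist x <= N (x - a). For the second, change the parameter from dist x to
    dist y for the averages at x, then the averages from x to y at the parameter
    dist y. All scales 2^k involved satisfy 3/4 dist x < 2 * 2^k, which is why
    the bounds of [ball_average], with dist x replaced by a multiple of 2^k, are
    uniform in k. *)
Lemma multiscale_extension : exists F : 'rV[R]_n.+1 -> Z,
  (forall x a, D a -> `|F x - f a| <= 12 * N (x - a)) /\
  (forall x y, 0 < dist x -> N (x - y) <= dist x / 4 ->
     `|F x - F y| <= 110 * rho N (x - y)).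
Proof.
have [kk hkk] := @dyadic_scale_choice R.
have /choice[A hA] (k : int) := ball_average hN D0 fD (@exprz2_gt0 R k).
have /choice[v hv] x : exists z, dist x = 0 -> forall a, D a -> `|z - f a| <= N (x - a).
  have [dx|dx] := eqVneq (dist x) 0; last by exists 0 => /eqP; rewrite (negbTE dx).
  by have [z hz] := closure_value hN D0 fD dx; exists z.
pose G x k := A k x.
pose F x := if 0 < dist x then interpolate kk (G x) (dist x) else v x.
have FE x : 0 < dist x -> F x = interpolate kk (G x) (dist x) by rewrite /F => ->.
exists F; split.
  (* With radii at most 2 dist x: N (x - a) + dist x + 10 dist x <= 12 N (x - a). *)
  move=> x a Da; have Nxa := is_norm_ge0 hN (x - a).
  have [dx|dx] := ltP 0 (dist x); last first.
    have dx0 : dist x = 0 by apply/eqP; rewrite eq_le dx ndist_ge0.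
    rewrite /F ltNge dx/= (le_trans (hv x dx0 a Da))//; lra.
  have [k1 k2] := hkk _ dx; have dxa := ndist_le hN D0 x Da.
  rewrite FE// -(interpolate_cst kk (f a) (dist x)).
  have h0 := (hA (kk (dist x))).1 x a Da; have h1 := (hA (kk (dist x) + 1)).1 x a Da.
  rewrite exprz2D1 in h1.
  have p0 := @exprz2_gt0 R (kk (dist x)).
  apply: (norm_interpolate hkk) => //; [apply: (le_trans h0)|apply: (le_trans h1)].
    clear -k1 p0 dxa Nxa; move: (2 ^ _) k1 p0 => p; lra.
  clear -k1 p0 dxa Nxa; move: (2 ^ _) k1 p0 => p; lra.
move=> x y dx xy.
have h1 := ndist_lipschitz hN D0 x y; have h2 := ndist_lipschitz hN D0 y x.
rewrite (is_normC hN y x) in h2.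
have dy : 0 < dist y by lra.
rewrite !FE//.
have step : `|interpolate kk (G x) (dist x) - interpolate kk (G x) (dist y)| <= 28 * N (x - y).
  have inc k : 3 / 4 * dist x < 2 * 2 ^ k -> `|G x (k + 1) - G x k| <= 28 * 2 ^ k.
    move=> hk; have p0 := @exprz2_gt0 R k.
    (* Any slack below half of 2^k is enough for the constant 28. *)
    have [a Da xa] := ndist_adherent hN D0 x (e := 2 ^ k / 10) ltac:(lra).
    have g0 := (hA k).1 x a Da; have g1 := (hA (k + 1)).1 x a Da.
    rewrite exprz2D1 in g1; have := ler_distD (f a) (G x (k + 1)) (G x k).
    rewrite (distrC (f a)) /G; lra.
  have [xley|yltx] := leP (dist x) (dist y).
    rewrite distrC; apply: (@le_trans _ _ (28 * (dist y - dist x))); last lra.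
    apply: (interpolate_lipschitz hkk) => //; first lra.
    by move=> k hk; apply: inc; lra.
  apply: (@le_trans _ _ (28 * (dist x - dist y))); last lra.
  apply: (interpolate_lipschitz hkk) => //; [lra|lra|].
  by move=> k hk; apply: inc; lra.
have r0 := rho_ge0 hN (x - y).
have level k : 3 / 4 * dist x < 2 * 2 ^ k -> `|G x k - G y k| <= 26 * rho N (x - y).
  move=> hk; have p0 := @exprz2_gt0 R k.
  rewrite /G (le_trans ((hA k).2 x y))// mulrAC ler_pdivrMr//.
  have N0 := is_norm_ge0 hN (x - y).
  have : 2 * dist x + 2 * N (x - y) + 6 * 2 ^ k <= 13 * 2 ^ k by lra.
  have : 0 <= 2 * rho N (x - y) by lra.
  move: (rho N (x - y)) (_ ^ k) (2 * dist x + _ + _) => a b c; nra.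
have move_ : `|interpolate kk (G x) (dist y) - interpolate kk (G y) (dist y)| <= 26 * rho N (x - y).
  have [k1 k2] := hkk _ dy; rewrite exprz2D1 in k2.
  have p0 := @exprz2_gt0 R (kk (dist y)).
  have k3 : 3 / 4 * dist x < 2 * 2 ^ kk (dist y).
    clear -k2 h1 xy; move: (2 ^ _) k2 => p; lra.
  apply: (norm_interpolate hkk) => //; apply: level => //.
  by rewrite exprz2D1 (lt_le_trans k3)// ler_pM2l// ler_peMl// ?ler1n// ltW.
(* The constant is 28 * 3 + 26, by N <= 3 rho. *)
have := ler_distD (interpolate kk (G x) (dist y)) (interpolate kk (G x) (dist x))
  (interpolate kk (G y) (dist y)).
have := is_norm_le_rho hN (x - y); lra.
Qed.

Lemma lipschitz_extension : exists2 F : 'rV[R]_n.+1 -> Z,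
  (forall x, D x -> F x = f x) &
  (forall x y, `|F x - F y| <= 400 * rho N (x - y)).
Proof.
have [F [Fa Fn]] := multiscale_extension.
exists F.
  move=> x Dx; apply/eqP; rewrite -subr_eq0 -normr_le0.
  by rewrite (le_trans (Fa x x Dx))// subrr is_norm0// mulr0.
have far x y : dist x <= 4 * N (x - y) -> `|F x - F y| <= 400 * rho N (x - y).
  move=> dxy; have [->|xny] := eqVneq x y.
    by rewrite subrr normr0 mulr_ge0// rho_ge0.
  have Nxy : 0 < N (x - y) by rewrite is_norm_gt0// subr_eq0.
  (* This a has N (x - a) <= 5 N (x - y), so F x - F y costs 12 * 11 N <= 396 rho. *)
  have [a Da xa] := ndist_adherent hN D0 x Nxy.
  have g1 := Fa x a Da; have g2 := Fa y a Da.
  have g3 := is_norm_split hN x y a; rewrite (is_normC hN y x) in g3.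
  have := is_norm_le_rho hN (x - y); have := ler_distD (f a) (F x) (F y).
  rewrite (distrC (f a)); lra.
move=> x y; have r0 := rho_ge0 hN (x - y).
have [/far//|dxy] := leP (dist x) (4 * N (x - y)).
have N0 := is_norm_ge0 hN (x - y).
rewrite (le_trans (Fn x y _ _))//; lra.
Qed.

End extension.

Theorem theorem29 (R : realType) :
  exists2 C : R, 0 < C &
    forall (n : nat) (N : 'rV[R]_n -> R) (Z : completeNormedModType R)
      (D : set 'rV[R]_n) (f : 'rV[R]_n -> Z),
    is_norm N ->
    (forall x y, D x -> D y -> `|f x - f y| <= N (x - y)) ->
    exists2 F : 'rV[R]_n -> Z,
      (forall x, D x -> F x = f x) &
      (forall x y, `|F x - F y| <=
         C * (polar_projection_norm N (x - y) / fine (vol (unit_ball N)))).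
Proof.
exists 400 => // n N Z D f hN fD.
have rhs0 x : 0 <= polar_projection_norm N x / fine (vol (unit_ball N)).
  by rewrite divr_ge0 ?polar_projection_norm_ge0// fine_ge0// vol_ge0.
have [D0|D0] := pselect (D !=set0); last first.
  exists (fun=> 0) => [x Dx|x y]; first by case: D0; exists x.
  by rewrite subrr normr0 mulr_ge0.
case: n N D f hN fD rhs0 D0 => [|n] N D f hN fD rhs0 D0; last exact: lipschitz_extension.
(* In dimension 0 there is only one point. *)
exists f => // x y; have -> : x = y by apply/rowP => -[].
by rewrite (subrr (f y)) normr0 mulr_ge0.
Qed.
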